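(* Let $\alpha\in(0,1)$ and let $\Omega$ be an $\alpha$-subhyperbolic domain in $\mathbb{R}^n$ with constants $C_{\alpha,\Omega},\theta_{\alpha,\Omega}$. There exist constants $\alpha^*\in(0,\alpha)$ and $\theta,C>0$, depending only on $n,\alpha,C_{\alpha,\Omega},\theta_{\alpha,\Omega}$, such that the following holds. For every $\varepsilon>0$ and every $x,y\in\Omega$ with $\|x-y\|\le\theta$ there exist a rectifiable curve $\Gamma\subset\Omega$ joining $x$ to $y$ and a subset $\Gamma_{\varepsilon}\subset\Gamma$ consisting of finitely many arcs such that: (i) for every $\tau\in[\alpha^*,\alpha]$, $\int_{\Gamma_\varepsilon}\operatorname{dist}(z,\partial\Omega)^{\tau-1}\,ds(z)\le C\|x-y\|^\tau$; and for every ball $B$ centered at a point of $\Gamma_\varepsilon$ with radius at most $\|x-y\|$, $\operatorname{diam}B\le C\,\operatorname{length}(B\cap\Gamma_\varepsilon)$; (ii) $\operatorname{length}(\Gamma)\le C\|x-y\|$, $\operatorname{length}(\Gamma\setminus\Gamma_\varepsilon)<\varepsilon$, and $\int_{\Gamma\setminus\Gamma_\varepsilon}\operatorname{dist}(z,\partial\Omega)^{\alpha-1}\,ds(z)\le C\|x-y\|^\alpha$.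
   Context: $\|\cdot\|$ is the Euclidean norm, $ds$ arc length. For $\alpha\in(0,1]$ and a domain $\Omega\subset\mathbb{R}^n$, the subhyperbolic distance is $d_{\alpha,\Omega}(x,y)=\inf_\gamma\int_\gamma \operatorname{dist}(z,\partial\Omega)^{\alpha-1}ds(z)$, the infimum over rectifiable curves $\gamma\subset\Omega$ joining $x$ to $y$. $\Omega$ is $\alpha$-subhyperbolic if there exist constants $C_{\alpha,\Omega}>0$, $\theta_{\alpha,\Omega}>0$ with $d_{\alpha,\Omega}(x,y)\le C_{\alpha,\Omega}\|x-y\|^\alpha$ for all $x,y\in\Omega$ with $\|x-y\|\le\theta_{\alpha,\Omega}$. *)

(* Defs.v *)
From HB Require Import structures.
From mathcomp Require Import all_boot all_order all_algebra.
From mathcomp Require Import all_classical all_reals all_analysis.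
Set Implicit Arguments. Unset Strict Implicit. Unset Printing Implicit Defensive.
Import Order.TTheory GRing.Theory Num.Theory.
Import numFieldNormedType.Exports.
Local Open Scope classical_set_scope.
Local Open Scope ring_scope.

Section Defs.
Variables (R : realType) (n : nat).
Local Notation V := 'rV[R]_n.

Definition enorm (v : V) : R := Num.sqrt (\sum_(i < n) (v ord0 i) ^+ 2).

Definition bd (O : set V) : set V :=
  [set w | forall r : R, 0 < r ->
     (exists z, O z /\ enorm (z - w) < r) /\ (exists z, ~ O z /\ enorm (z - w) < r)].

(* dist(z, boundary O), +oo if the boundary is empty *)
Definition dist_bd (O : set V) (z : V) : \bar R :=
  ereal_inf [set (enorm (z - w))%:E | w in bd O].

Definition wt (O : set V) (tau : R) (z : V) : \bar R :=
  match dist_bd O z with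
  | r%:E => (r `^ (tau - 1))%:E
  | +oo%E => if tau < 1 then 0%E else 1%E
  | -oo%E => 0%E
  end.

(* Lower Darboux-type sum of f along gamma for a partition a = t_0 < t_1 < ... < t_m,
   where p = [:: t_1; ...; t_m]:  sum_i (inf_{[t_i,t_{i+1}]} f o gamma) * ||gamma t_{i+1} - gamma t_i|| *)
Definition lowsum (gamma : R -> V) (f : V -> \bar R) (a : R) (p : seq R) : \bar R :=
  (\sum_(uv <- zip (a :: p) p)
     ereal_inf [set f (gamma t) | t in `[uv.1, uv.2]] *
     (enorm (gamma uv.2 - gamma uv.1))%:E)%E.

(* Line integral  int_{gamma|[a,b]} f ds  with respect to arc length, for f >= 0
   (lower semicontinuous): supremum of the lower sums over all partitions of [a,b].
   With f = 1 this is the length of gamma|[a,b]. *)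
Definition lineint (gamma : R -> V) (a b : R) (f : V -> \bar R) : \bar R :=
  ereal_sup [set lowsum gamma f a p | p in [set p : seq R | path <%R a p /\ last a p = b]].

Definition curve_length (gamma : R -> V) (a b : R) : \bar R :=
  lineint gamma a b (fun _ => 1%E).

Definition rect_curve (O : set V) (x y : V) (gamma : R -> V) : Prop :=
  {within `[0, 1], continuous gamma} /\ gamma 0 = x /\ gamma 1 = y /\
  (forall t, 0 <= t <= 1 -> O (gamma t)) /\
  (curve_length gamma 0 1 < +oo)%E.

Definition subhyp_dist (alpha : R) (O : set V) (x y : V) : \bar R :=
  ereal_inf [set lineint gamma 0 1 (wt O alpha) | gamma in rect_curve O x y].

Definition domain (O : set V) : Prop := open O /\ connected O /\ O !=set0.

Definition subhyperbolic (alpha : R) (O : set V) (C theta : R) : Prop :=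
  0 < C /\ 0 < theta /\
  forall x y, O x -> O y -> enorm (x - y) <= theta ->
    (subhyp_dist alpha O x y <= (C * enorm (x - y) `^ alpha)%:E)%E.

Definition diam (B : set V) : \bar R :=
  ereal_sup [set (enorm (u - v))%:E | u in B & v in B].

Definition eball (c : V) (r : R) : set V := [set z | enorm (z - c) < r].

(* A finite family of arcs of gamma|[0,1], given by parameter intervals
   [a_1,b_1], ..., [a_m,b_m] with 0 <= a_1 < b_1 <= a_2 < b_2 <= ... < b_m <= 1. *)
Definition arcs_ok (s : seq (R * R)) : Prop :=
  sorted <=%R (0 :: flatten [seq [:: ab.1; ab.2] | ab <- s] ++ [:: 1]) /\
  all (fun ab => ab.1 < ab.2) s.

(* the complementary parameter intervals (gamma \ gamma_eps) *)
Definition gaps (s : seq (R * R)) : seq (R * R) :=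
  zip (0 :: map snd s) (map fst s ++ [:: 1]).

Definition arcs_int (gamma : R -> V) (s : seq (R * R)) (f : V -> \bar R) : \bar R :=
  (\sum_(ab <- s) lineint gamma ab.1 ab.2 f)%E.

Definition set_ind (B : set V) : V -> \bar R :=
  fun z => if `[< B z >] then 1%E else 0%E.

End Defs.

(* Main.v *)
(* Let D = |x - y| and let d be the distance to the boundary. At a small scale sg,
   join x to y by points of O with steps at most sg, almost minimizing the cost
   sum of sg * max(d, sg)^(alpha - 1). Subhyperbolicity and near-minimality bound
   the cost of any N consecutive steps by a multiple of (N sg)^alpha. As d is
   1-Lipschitz this makes the weight max(d, sg)^(alpha - 1) an A_1 weight along the
   chain, uniformly in sg, and such weights self-improve to exponents tau - 1 with
   tau slightly below alpha. The steps from points with d > 4 sg become straight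
   segments and form Gamma_eps. Only O((D / sg)^alpha) steps remain, of total length
   O(D^alpha sg^(1 - alpha)), which tends to 0 with sg; they are replaced by curves
   given by the hypothesis. *)

(* A curve minimizing the subhyperbolic length need not exist. For chains the infimum is taken over
   finite sums, where a tolerance [sg^al], the most that one step can cost, is harmless, and after
   division by [sg] the weight is governed by a sequence [e k >= 1] that changes by at most 2 per
   step. For such a sequence self-improvement is an induction on blocks of length [M ^ j]. All
   constants are independent of [sg], so [sg] can be chosen last, according to [eps]. The number [Q]
   turns bounds on cost into bounds on length. The weight decays away from the boundary, so a cheap
   curve might be long by running deep inside the domain; but one that starts within [2 h] of the
   boundary and gets about [Q h] away from it has already cost too much. If the distance from [x] to
   the boundary is at least [2 D], or the boundary is empty, the segment from [x] to [y] serves as a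
   single arc. Balls centered on Gamma_eps are treated by radius: up to a fixed multiple of [sg] the
   edge carrying the center suffices; beyond it, a run of consecutive edges lies in the ball and at
   least half of them are kept. *)
Require Import Defs.
From HB Require Import structures.
From mathcomp Require Import all_boot all_order all_algebra.
From mathcomp Require Import all_classical all_reals all_analysis.
From mathcomp Require Import zify ring lra.
Set Implicit Arguments. Unset Strict Implicit. Unset Printing Implicit Defensive.
Import Order.TTheory GRing.Theory Num.Theory.
Import numFieldNormedType.Exports.
Local Open Scope classical_set_scope.
Local Open Scope ring_scope.

(** * Euclidean norm *)

Section EuclideanNorm.
Variables (R : realType) (n : nat).
Local Notation V := 'rV[R]_n.
Implicit Types u v w : V.

Lemma enorm_ge0 v : 0 <= enorm v.
Proof. exact: sqrtr_ge0. Qed.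

Lemma sqr_enorm v : enorm v ^+ 2 = \sum_(i < n) v ord0 i ^+ 2.
Proof. by rewrite sqr_sqrtr// sumr_ge0// => i _; rewrite sqr_ge0. Qed.

Lemma enormZ (a : R) v : enorm (a *: v) = `|a| * enorm v.
Proof.
rewrite /enorm -sqrtr_sqr -sqrtrM ?sqr_ge0// mulr_sumr; congr Num.sqrt.
by apply: eq_bigr => i _; rewrite mxE exprMn.
Qed.

Lemma enorm0 : enorm (0 : V) = 0.
Proof. by rewrite -(scale0r (0 : V)) enormZ normr0 mul0r. Qed.

Lemma enormN v : enorm (- v) = enorm v.
Proof. by rewrite -scaleN1r enormZ normrN1 mul1r. Qed.

Lemma enormB u v : enorm (u - v) = enorm (v - u).
Proof. by rewrite -enormN opprB. Qed.

Lemma coord_le_enorm v i : `|v ord0 i| <= enorm v.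
Proof.
rewrite -sqrtr_sqr ler_sqrt; last by rewrite sumr_ge0// => j _; rewrite sqr_ge0.
by rewrite (bigD1 i)//= lerDl sumr_ge0// => j _; rewrite sqr_ge0.
Qed.

Lemma enorm_eq0 v : enorm v = 0 -> v = 0.
Proof.
move=> v0; apply/rowP => i; rewrite mxE; apply/eqP.
by rewrite -normr_le0 -v0 coord_le_enorm.
Qed.

(** Sum the inequalities [(|v| u_i - |u| v_i)^2 >= 0] over the coordinates and divide by
    [2 |u| |v|]; the two vanishing cases are set apart for this division. *)
Lemma cauchy_schwarz u v :
  \sum_(i < n) u ord0 i * v ord0 i <= enorm u * enorm v.
Proof.
have [u0|u0] := eqVneq (enorm u) 0.
  rewrite u0 mul0r (enorm_eq0 u0) big1// => i _; by rewrite mxE mul0r.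
have [v0|v0] := eqVneq (enorm v) 0.
  rewrite v0 mulr0 (enorm_eq0 v0) big1// => i _; by rewrite mxE mulr0.
have uv : 0 < 2 * (enorm u * enorm v).
  by rewrite !mulr_gt0// lt_neqAle eq_sym ?u0 ?v0 enorm_ge0.
rewrite -(ler_pM2l uv) mulr_sumr.
apply: (@le_trans _ _ (\sum_(i < n) (enorm v ^+ 2 * u ord0 i ^+ 2 + enorm u ^+ 2 * v ord0 i ^+ 2))).
  apply: ler_sum => i _.
  have := sqr_ge0 (enorm v * u ord0 i - enorm u * v ord0 i); nra.
rewrite big_split/= -!mulr_sumr -!sqr_enorm; nra.
Qed.

Lemma enormD u v : enorm (u + v) <= enorm u + enorm v.
Proof.
rewrite -(@ler_pXn2r _ 2)// ?nnegrE ?addr_ge0 ?enorm_ge0//.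
rewrite sqr_enorm sqrrD !sqr_enorm.
under eq_bigr do rewrite mxE sqrrD.
rewrite big_split/= big_split/= lerD2r lerD2l sumrMnl lerMn2r/=; exact: cauchy_schwarz.
Qed.

Lemma enorm_triangle w u v : enorm (u - v) <= enorm (u - w) + enorm (w - v).
Proof. by rewrite (le_trans _ (enormD _ _))// addrA subrK. Qed.

(** Openness and continuity on ['rV[R]_n] refer to the sup norm, lengths and distances to the
    Euclidean one; this bound and the next translate between them. *)
Lemma normr_le_enorm v : `|v| <= enorm v.
Proof.
rewrite /Num.norm/= mx_normrE; apply: bigmax_le; first exact: enorm_ge0.
by move=> [i j] _ /=; rewrite ord1 coord_le_enorm.
Qed.

Lemma enorm_le_normr v : enorm v <= n%:R * `|v|.
Proof.
have le_coord i : `|v ord0 i| <= `|v|.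
  by rewrite [X in _ <= X]/Num.norm/= mx_normrE (le_bigmax _ (fun ij => `|v ij.1 ij.2|) (ord0, i)).
rewrite -(@ler_pXn2r _ 2)// ?nnegrE ?enorm_ge0 ?mulr_ge0//.
rewrite sqr_enorm (@le_trans _ _ (\sum_(i < n) `|v| ^+ 2))//.
  by apply: ler_sum => i _; rewrite -real_normK ?num_real// lerXn2r ?nnegrE.
rewrite sumr_const card_ord exprMn -[leLHS]mulr_natl ler_wpM2r ?sqr_ge0//.
by rewrite -natrX ler_nat; nia.
Qed.

End EuclideanNorm.

(** * Real powers *)

Section PowR.
Variable R : realType.
Implicit Types x y : R.

Lemma le_powR_neg x y (s : R) : 0 < x -> x <= y -> s <= 0 -> y `^ s <= x `^ s.
Proof.
move=> x0 xy; rewrite -oppr_ge0 -{2 3}[s]opprK; move: (- s) => r r0.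
have y0 : 0 < y by apply: lt_le_trans xy.
rewrite !powRN lef_pV2 ?posrE ?powR_gt0//.
by rewrite ge0_ler_powR ?nnegrE// ltW.
Qed.

Lemma powRD_gt0 x (a b : R) : 0 < x -> x `^ (a + b) = x `^ a * x `^ b.
Proof. by move=> x0; rewrite powRD// (gt_eqF x0) implybT. Qed.

Lemma mul_powRB1 x (a : R) : 0 < x -> x * x `^ (a - 1) = x `^ a.
Proof.
by move=> x0; rewrite -{1}[x]powRr1 ?ltW// -powRD_gt0//; congr (_ `^ _); ring.
Qed.

Lemma sum_ge_const (F : nat -> R) (c : R) a b : (forall k, (a <= k < b)%N -> c <= F k) ->
  (b - a)%:R * c <= \sum_(a <= k < b) F k.
Proof.
move=> Fc; rewrite mulr_natl -sumr_const_nat !big_nat.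
by apply: ler_sum => k /Fc.
Qed.

Lemma powR_invK x (b : R) : 0 <= x -> b != 0 -> (x `^ b^-1) `^ b = x.
Proof. by move=> x0 b0; rewrite -powRrM mulVf// powRr1. Qed.

End PowR.

(** * Line integrals *)

Section LineIntegral.
Variables (R : realType) (n : nat).
Local Notation V := 'rV[R]_n.
Implicit Types (g : R -> V) (f h : V -> \bar R).
Local Open Scope ereal_scope.

Definition seg_term g f (s t : R) : \bar R :=
  ereal_inf [set f (g r) | r in `[s, t]%classic] * (enorm (g t - g s))%:E.

Lemma lowsum_nil g f a : lowsum g f a [::] = 0.
Proof. by rewrite /lowsum /= big_nil. Qed.

Lemma lowsum_cons g f a b p :
  lowsum g f a (b :: p) = seg_term g f a b + lowsum g f b p.
Proof. by rewrite /lowsum /= big_cons. Qed.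

Lemma seg_term_ge0 g f s t : (forall z, 0 <= f z) -> 0 <= seg_term g f s t.
Proof.
move=> f0; rewrite mule_ge0 ?lee_fin ?enorm_ge0//.
by apply: le_ereal_inf_tmp => _ [r _ <-].
Qed.

Lemma lowsum_ge0 g f a p : (forall z, 0 <= f z) -> 0 <= lowsum g f a p.
Proof.
move=> f0; elim: p a => [|b p IH] a; first by rewrite lowsum_nil.
by rewrite lowsum_cons adde_ge0 ?seg_term_ge0.
Qed.

Lemma seg_term_le g g' f f' s t : (forall z, 0 <= f z) ->
  (forall r, (s <= r <= t)%R -> f (g r) <= f' (g' r)) ->
  (s <= t)%R -> enorm (g t - g s) = enorm (g' t - g' s) ->
  seg_term g f s t <= seg_term g' f' s t.
Proof.
move=> f0 ff' st gg'; rewrite /seg_term gg' lee_wpmul2r ?lee_fin ?enorm_ge0//.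
apply: le_ereal_inf_tmp => _ [r /= rst <-].
apply: (@le_trans _ _ (f (g r))); last by apply: ff'; rewrite in_itv/= in rst.
by apply: ereal_inf_lbound; exists r.
Qed.

Lemma lineint_ubP g f a b M :
  (forall p, path <%R a p -> last a p = b -> lowsum g f a p <= M) ->
  lineint g a b f <= M.
Proof. by move=> H; apply: ge_ereal_sup => _ [p [pp lp] <-]; exact: H. Qed.

Lemma lowsum_lineint g f a b p : path <%R a p -> last a p = b ->
  lowsum g f a p <= lineint g a b f.
Proof. by move=> pp lp; apply: ereal_sup_ubound; exists p. Qed.

Lemma lineint_refl g f a : lineint g a a f = 0.
Proof.
apply/eqP; rewrite eq_le; apply/andP; split.
  apply: lineint_ubP => -[|b p] /=; first by rewrite lowsum_nil.
  move=> /andP[ab pp] lp; have := order_path_min lt_trans pp => /allP.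
  have /orP[/eqP lb|lb] : (last b p == b) || (last b p \in p).
  - by have := mem_last b p; rewrite inE.
  - by move: ab; rewrite -lb lp ltxx.
  - by move=> /(_ _ lb); rewrite lp => /(lt_trans ab); rewrite ltxx.
by rewrite -(lowsum_nil g f a) lowsum_lineint.
Qed.

Lemma path_lt_last (a : R) p : path <%R a p -> (a <= last a p)%R.
Proof.
elim: p a => //= b p IH a /andP[ab /IH]; exact: le_trans (ltW ab).
Qed.

Lemma lineint_ge0 g f a b : (a <= b)%R -> (forall z, 0 <= f z) ->
  0 <= lineint g a b f.
Proof.
move=> ab f0; rewrite le_eqVlt in ab; case/orP: ab => [/eqP->|ab].
  by rewrite lineint_refl.
apply: le_trans (@lowsum_lineint g f a b [:: b] _ _); rewrite /= ?ab//.
exact: lowsum_ge0.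
Qed.

(** An increasing affine change of parameter carries partitions to partitions and leaves every term
    of the lower sum in place. It serves to read off the pieces of a concatenated curve. *)
Lemma lineint_affine_le g g' f (k c a b : R) : (0 < k)%R ->
  (forall z, 0 <= f z) ->
  (forall t, (a <= t <= b)%R -> g t = g' (k * t + c)%R) ->
  lineint g a b f <= lineint g' (k * a + c) (k * b + c) f.
Proof.
move=> k0 f0 gg'; apply: lineint_ubP => p pp lp.
pose phi t := (k * t + c)%R.
have phi_lt : {homo phi : x y / (x < y)%R}.
  by move=> x y xy; rewrite /phi ltrD2r ltr_pM2l.
apply: (@le_trans _ _ (lowsum g' f (phi a) (map phi p))); last first.
  apply: lowsum_lineint; last by rewrite last_map lp.
  by rewrite path_map; apply: sub_path pp => x y /phi_lt.
(* The induction on the partition moves its first point, which is therefore generalized to some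
   [a' >= a], while the hypothesis on [[a, b]] keeps the original [a]. *)
have := lexx a; move: pp lp; move: {1 2 4 5 6}a => a' pp lp aa'.
elim: p a' pp lp aa' => [|d p IH] a' /=; first by rewrite !lowsum_nil.
move=> /andP[ad pp] lp aa'; rewrite !lowsum_cons leeD//; last first.
  by apply: IH => //; apply: le_trans aa' (ltW ad).
have db : (d <= b)%R by rewrite -lp path_lt_last.
rewrite /seg_term -(gg' d) ?(le_trans aa' (ltW ad))//.
rewrite -(gg' a') ?aa' ?(le_trans (ltW ad) db)//.
rewrite lee_wpmul2r ?lee_fin ?enorm_ge0//.
apply: le_ereal_inf_tmp => _ [r /= rad <-]; apply: ereal_inf_lbound.
move: rad; rewrite in_itv/= => /andP[ar rd].
exists ((r - c) / k)%R => /=.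
  rewrite in_itv/= ler_pdivlMr// ler_pdivrMr// lerBrDr lerBlDr.
  by rewrite ![(_ * k)%R]mulrC ar rd.
have kr : (k * ((r - c) / k) + c = r)%R by field; rewrite gt_eqF.
rewrite gg' ?kr// ler_pdivlMr// ler_pdivrMr// lerBrDr lerBlDr.
rewrite ![(_ * k)%R]mulrC (le_trans _ ar) ?(le_trans rd) ?lerD2r//.
- by rewrite ler_pM2l.
- by rewrite ler_pM2l.
Qed.

Lemma lowsum_cat g f a p q :
  lowsum g f a (p ++ q) = lowsum g f a p + lowsum g f (last a p) q.
Proof.
elim: p a => [|b p IH] a /=; first by rewrite lowsum_nil add0e.
by rewrite !lowsum_cons IH addeA.
Qed.

(** Partitions of the two halves concatenate. The two suprema are taken one after the other by
    subtracting the other term, which requires finiteness; hence the separate case of an infinite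
    right side. *)
Lemma lineint_superadd g f a b c : (a <= b)%R -> (b <= c)%R ->
  (forall z, 0 <= f z) ->
  lineint g a b f + lineint g b c f <= lineint g a c f.
Proof.
move=> ab bc f0.
have cat_le p q : path <%R a p -> last a p = b -> path <%R b q -> last b q = c ->
    lowsum g f a p + lowsum g f b q <= lineint g a c f.
  move=> pp lp pq lq; rewrite -[in lowsum g f b q]lp -lowsum_cat.
  by apply: lowsum_lineint; rewrite ?cat_path ?last_cat ?lp ?pp.
have [->|] := eqVneq (lineint g a c f) +oo; first by rewrite leey.
rewrite -ltey => Lfin.
have L0 : 0 <= lineint g a c f by rewrite lineint_ge0// (le_trans ab).
have Lf : lineint g a c f \is a fin_num by rewrite ge0_fin_numE.
have step q : path <%R b q -> last b q = c ->
    lineint g a b f <= lineint g a c f - lowsum g f b q.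
  move=> pq lq; apply: lineint_ubP => p pp lp.
  have qf : lowsum g f b q \is a fin_num.
    rewrite ge0_fin_numE ?lowsum_ge0//; apply: le_lt_trans Lfin.
    by apply: le_trans (cat_le _ _ pp lp pq lq); rewrite leeDr ?lowsum_ge0.
  by rewrite leeBrDr// cat_le.
have [p0 [pp0 lp0]] : exists p, path <%R a p /\ last a p = b.
  move: ab; rewrite le_eqVlt => /orP[/eqP->|ab]; first by exists [::].
  by exists [:: b]; rewrite /= ab.
have [q0 [pq0 lq0]] : exists p, path <%R b p /\ last b p = c.
  move: bc; rewrite le_eqVlt => /orP[/eqP->|bc]; first by exists [::].
  by exists [:: c]; rewrite /= bc.
have q0f : lowsum g f b q0 \is a fin_num.
  rewrite ge0_fin_numE ?lowsum_ge0//; apply: le_lt_trans Lfin.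
  by apply: le_trans (cat_le _ _ pp0 lp0 pq0 lq0); rewrite leeDr ?lowsum_ge0.
have abf : lineint g a b f \is a fin_num.
  rewrite ge0_fin_numE ?lineint_ge0//; apply: le_lt_trans Lfin.
  apply: le_trans (step _ pq0 lq0) _.
  by rewrite leeBlDr// ?leeDl ?lowsum_ge0.
rewrite addeC -leeBrDr//; apply: lineint_ubP => q pq lq.
have := step _ pq lq.
have qf : lowsum g f b q \is a fin_num.
  rewrite ge0_fin_numE ?lowsum_ge0//; apply: le_lt_trans Lfin.
  by apply: le_trans (cat_le _ _ pp0 lp0 pq lq); rewrite leeDr ?lowsum_ge0.
by rewrite !leeBrDr// addeC.
Qed.

Lemma seg_term_split g f a b c : (a <= b)%R -> (b <= c)%R -> (forall z, 0 <= f z) ->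
  seg_term g f a c <= seg_term g f a b + seg_term g f b c.
Proof.
move=> ab bc f0; rewrite /seg_term.
set I := ereal_inf _; set J := ereal_inf _; set K := ereal_inf _.
have I0 : 0 <= I by apply: le_ereal_inf_tmp => _ [r _ <-].
have IJ : I <= J.
  apply: le_ereal_inf_tmp => _ [r /= + <-]; rewrite in_itv/= => /andP[ar rb].
  by apply: ereal_inf_lbound; exists r => //=; rewrite in_itv/= ar (le_trans rb).
have IK : I <= K.
  apply: le_ereal_inf_tmp => _ [r /= + <-]; rewrite in_itv/= => /andP[ar rb].
  by apply: ereal_inf_lbound; exists r => //=; rewrite in_itv/= rb (le_trans ab).
apply: (@le_trans _ _ (I * (enorm (g b - g a))%:E + I * (enorm (g c - g b))%:E)).
  rewrite -ge0_muleDr ?lee_fin ?enorm_ge0// lee_wpmul2l// -EFinD lee_fin [leRHS]addrC.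
  exact: enorm_triangle.
by apply: leeD; apply: lee_wpmul2r; rewrite ?lee_fin ?enorm_ge0.
Qed.

(** Inserting [b] into a partition does not decrease its lower sum: infima over smaller cells grow
    and the chord obeys the triangle inequality. *)
Lemma lineint_subadd g f a b c : (a <= b)%R -> (b <= c)%R ->
  (forall z, 0 <= f z) ->
  lineint g a c f <= lineint g a b f + lineint g b c f.
Proof.
move=> ab bc f0; apply: lineint_ubP => p pp lp.
elim: p a ab pp lp => [|d p IH] a ab /=.
  by rewrite lowsum_nil => _ _; rewrite adde_ge0// lineint_ge0.
move=> /andP[ad pp] lp; rewrite lowsum_cons.
have [db|bd] := leP d b.
  apply: le_trans (leeD2l _ (IH _ db pp lp)) _; rewrite addeA leeD2r//.
  apply: le_trans (lineint_superadd _ (ltW ad) db f0); rewrite leeD2r//.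
  have <- : lowsum g f a [:: d] = seg_term g f a d.
    by rewrite lowsum_cons lowsum_nil adde0.
  by apply: lowsum_lineint; rewrite /= ?ad.
apply: le_trans (leeD2r _ (seg_term_split g ab (ltW bd) f0)) _.
rewrite -addeA leeD//.
  move: ab; rewrite le_eqVlt => /orP[/eqP->|ab].
    by rewrite lineint_refl /seg_term subrr enorm0 mule0.
  have <- : lowsum g f a [:: b] = seg_term g f a b.
    by rewrite lowsum_cons lowsum_nil adde0.
  by apply: lowsum_lineint; rewrite /= ?ab.
by rewrite -lowsum_cons; apply: lowsum_lineint; rewrite /= ?bd.
Qed.

Lemma lineint_sub g f a b c d : (a <= b)%R -> (b <= c)%R -> (c <= d)%R ->
  (forall z, 0 <= f z) -> lineint g b c f <= lineint g a d f.
Proof.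
move=> ab bc cd f0.
apply: le_trans (lineint_superadd _ (le_trans ab bc) cd f0).
apply: le_trans (leeDl _ (lineint_ge0 _ cd f0)).
by apply: le_trans (lineint_superadd _ ab bc f0); rewrite leeDr// lineint_ge0.
Qed.

Lemma chord_le_lineint g f (c : R) a b : (a <= b)%R ->
  (forall t, (a <= t <= b)%R -> c%:E <= f (g t)) ->
  (c * enorm (g b - g a))%:E <= lineint g a b f.
Proof.
rewrite le_eqVlt => /orP[/eqP->|ab] cf.
  by rewrite lineint_refl subrr enorm0 mulr0.
apply: le_trans (@lowsum_lineint g f a b [:: b] _ _); rewrite /= ?ab//.
rewrite lowsum_cons lowsum_nil adde0 EFinM lee_wpmul2r ?lee_fin ?enorm_ge0//.
by apply: le_ereal_inf_tmp => _ [r /= + <-]; rewrite in_itv/= => /cf.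
Qed.

(** This converts cost into length for a curve known to stay near the boundary, where the weight is
    bounded below. *)
Lemma length_le_lineint g f (c : R) a b : (0 < c)%R -> (a <= b)%R ->
  (forall t, (a <= t <= b)%R -> c%:E <= f (g t)) -> (forall z, 0 <= f z) ->
  lineint g a b (fun=> 1) <= (c^-1)%:E * lineint g a b f.
Proof.
move=> c0 ab cf f0; apply: lineint_ubP => p pp lp.
apply: (@le_trans _ _ ((c^-1)%:E * lowsum g f a p)); last first.
  by rewrite lee_wpmul2l ?lee_fin ?invr_ge0 ?(ltW c0)// lowsum_lineint.
have := lexx a; move: pp lp; move: {1 2 4 5 6}a => a' pp lp aa'.
elim: p a' pp lp aa' => [|d p IH] a' /=; first by rewrite !lowsum_nil mule0.
move=> /andP[ad pp] lp aa'; rewrite !lowsum_cons ge0_muleDr ?seg_term_ge0 ?lowsum_ge0//.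
rewrite leeD//; last by apply: IH => //; apply: le_trans aa' (ltW ad).
have db : (d <= b)%R by rewrite -lp path_lt_last.
rewrite /seg_term muleA lee_wpmul2r ?lee_fin ?enorm_ge0//.
apply: (@le_trans _ _ ((c^-1)%:E * c%:E)).
  rewrite -EFinM mulVf ?gt_eqF//.
  by apply: ereal_inf_lbound; exists a' => //=; rewrite in_itv/= lexx ltW.
rewrite lee_wpmul2l ?lee_fin ?invr_ge0 ?(ltW c0)//.
apply: le_ereal_inf_tmp => _ [r /= + <-]; rewrite in_itv/= => /andP[ar rd].
by rewrite cf// (le_trans aa')//= (le_trans rd).
Qed.

Lemma lineint_segment_le g f (M k c : R) (u v : V) a b :
  (0 <= M)%R -> (0 <= k)%R -> (a <= b)%R -> (forall z, 0 <= f z) ->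
  (forall t, (a <= t <= b)%R -> g t = (u + (k * t + c) *: v)%R) ->
  (forall t, (a <= t <= b)%R -> f (g t) <= M%:E) ->
  lineint g a b f <= (M * (k * (b - a) * enorm v))%:E.
Proof.
move=> M0 k0 ab f0 gE fM; apply: lineint_ubP => p pp lp.
have := lexx a; move: pp lp; move: {1 2 4 5 6}a => a' pp lp aa'.
elim: p a' pp lp aa' => [|d p IH] a' /=.
  by rewrite lowsum_nil => _ -> _; rewrite subrr mulr0 mul0r mulr0.
move=> /andP[ad pp] lp aa'.
have db : (d <= b)%R by rewrite -lp path_lt_last.
have aad : (a <= d)%R by apply: le_trans aa' (ltW ad).
rewrite lowsum_cons; apply: le_trans (leeD2l _ (IH _ pp lp aad)) _.
rewrite (_ : M * (k * (b - a') * enorm v) =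
  M * (k * (d - a') * enorm v) + M * (k * (b - d) * enorm v))%R; last by ring.
rewrite EFinD leeD2r// /seg_term (gE d) ?aad// (gE a') ?aa' ?(le_trans (ltW ad))//.
have -> : (u + (k * d + c) *: v - (u + (k * a' + c) *: v) = (k * (d - a')) *: v)%R.
  by apply/rowP => i; rewrite !mxE; ring.
rewrite enormZ ger0_norm ?mulr_ge0 ?subr_ge0 ?(ltW ad)// [leRHS]EFinM lee_wpmul2r//.
  by rewrite lee_fin !mulr_ge0 ?enorm_ge0// subr_ge0 ltW.
apply: (@le_trans _ _ (f (g d))); last by apply: fM; rewrite aad.
by apply: ereal_inf_lbound; exists d => //=; rewrite in_itv/= lexx ltW.
Qed.

End LineIntegral.

(** * Distance to the boundary *)

Section BoundaryDistance.
Variables (R : realType) (n : nat).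
Local Notation V := 'rV[R]_n.
Variable O : set V.
Implicit Types u v w z : V.

(** The boundary point is [pt (sup S)], where the segment from [u] to [z] leaves [O] for the last
    time: points of [S] accumulate there, and all later parameters are outside [S]. *)
Lemma bd_between u z : O u -> ~ O z ->
  exists2 w, bd O w & enorm (u - w) <= enorm (u - z).
Proof.
move=> Ou Oz; pose pt (s : R) := u + s *: (z - u).
pose S := [set s : R | 0 <= s <= 1 /\ O (pt s)].
have S0 : S 0 by rewrite /S/= lexx ler01 /pt scale0r addr0.
have Sub : ubound S 1 by move=> s [/andP[]].
have Ssup : has_sup S by split; [exists 0 | exists 1].
have s0 : 0 <= sup S by apply: ub_le_sup => //; exists 1.
have s1 : sup S <= 1 by apply: ge_sup => //; exists 0.
have ptB s t : enorm (pt s - pt t) = `|s - t| * enorm (z - u).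
  by rewrite -enormZ; congr enorm; apply/rowP => i; rewrite !mxE; ring.
have pt1 : pt 1 = z by rewrite /pt scale1r addrC subrK.
have pt0 : pt 0 = u by rewrite /pt scale0r addr0.
exists (pt (sup S)); last first.
  rewrite -{1}pt0 ptB sub0r normrN ger0_norm// [leRHS]enormB.
  by rewrite ler_piMl ?enorm_ge0.
move=> r r0; set l := enorm (z - u) in ptB.
have l0 : 0 <= l := enorm_ge0 _.
have l1 : 0 < l + 1 by rewrite ltr_wpDl.
pose e := r / (l + 1); have e0 : 0 < e by rewrite divr_gt0.
have small x : `|x| < e -> `|x| * l < r.
  move=> xe; apply: le_lt_trans (_ : `|x| * (l + 1) < r).
    by rewrite ler_wpM2l// lerDl.
  by rewrite -ltr_pdivlMr.
split.
  have [s Ss es] := sup_adherent e0 Ssup.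
  exists (pt s); split; first by case: Ss.
  rewrite ptB small// ltr_norml.
  have : s <= sup S by apply: ub_le_sup => //; exists 1.
  by move: es e0; lra.
(* A parameter just beyond the supremum lies outside [O]; if this would pass the end of the segment,
   the end [z] itself is taken. *)
pose s := Num.min 1 (sup S + e / 2).
have s_gt : sup S <= s by rewrite /s le_min s1 lerDl ltW// divr_gt0.
exists (pt s); split.
  move=> Os; have : s <= sup S.
    apply: ub_le_sup; first by exists 1.
    split; last exact: Os.
    by rewrite (le_trans s0 s_gt)/= /s ge_min lexx.
  rewrite /s ge_min => /orP[s1'|]; last by move: e0; lra.
  apply: Oz; rewrite -pt1; suff <- : s = 1 by [].
  by apply/min_idPl; rewrite (le_trans s1')// lerDl ltW// divr_gt0.
rewrite ptB small// ger0_norm ?subr_ge0//.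
have : s <= sup S + e / 2 by rewrite /s ge_min lexx orbT.
by move: e0; lra.
Qed.

(* Meaningful only if [bd O] is nonempty: otherwise [fine +oo = 0]. *)
Definition dl z : R := fine (dist_bd O z).

Hypothesis bdO : bd O !=set0.

Lemma dist_bdE z : dist_bd O z = (dl z)%:E.
Proof.
rewrite /dl fineK// ge0_fin_numE.
  have [w bw] := bdO; apply: le_lt_trans (ltry (enorm (z - w))).
  by apply: ereal_inf_lbound; exists w.
by apply: le_ereal_inf_tmp => _ [w _ <-]; rewrite lee_fin enorm_ge0.
Qed.

Lemma dl_le z w : bd O w -> dl z <= enorm (z - w).
Proof.
move=> bw; rewrite -lee_fin -dist_bdE; apply: ereal_inf_lbound.
by exists w.
Qed.

Lemma le_dl z (c : R) : (forall w, bd O w -> c <= enorm (z - w)) -> c <= dl z.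
Proof.
move=> H; rewrite -lee_fin -dist_bdE; apply: le_ereal_inf_tmp => _ [w bw <-].
by rewrite lee_fin H.
Qed.

Lemma dl_lip z z' : dl z <= dl z' + enorm (z - z').
Proof.
rewrite -lerBlDr; apply: le_dl => w bw; rewrite lerBlDr addrC.
by rewrite (le_trans (dl_le _ bw))// (le_trans (enorm_triangle z' _ _)).
Qed.

Lemma dl_gt0 z : open O -> O z -> 0 < dl z.
Proof.
move=> oO Oz; have /nbhs_ballP[e /= e0 zO] : nbhs z O by apply: open_nbhs_nbhs.
apply: (@lt_le_trans _ _ (e / 2)); first by rewrite divr_gt0.
apply: le_dl => w bw; rewrite leNgt; apply/negP => zw.
have [_ [v [nOv vw]]] := bw (e / 2) (divr_gt0 e0 (ltr0Sn _ 1)).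
apply: nOv; apply: zO; rewrite -ball_normE/=.
apply: le_lt_trans (normr_le_enorm _) _.
apply: le_lt_trans (enorm_triangle w _ _) _.
rewrite (splitr e) ltrD//; by rewrite enormB.
Qed.

(** Otherwise [bd_between] would produce a boundary point nearer to [u] than [dl u]. *)
Lemma dl_ball u z : O u -> enorm (u - z) < dl u -> O z.
Proof.
move=> Ou uz; apply: contrapT => nOz; have [w bw uw] := bd_between Ou nOz.
by move: (dl_le u bw); rewrite leNgt (le_lt_trans uw uz).
Qed.

Lemma wtE tau z : wt O tau z = (dl z `^ (tau - 1))%:E.
Proof. by rewrite /wt dist_bdE. Qed.

End BoundaryDistance.

(** * Continuity in the Euclidean norm and uniform grids *)

Lemma within_itv_continuousP (R : realType) (n : nat) (g : R -> 'rV[R]_n) (a b : R) :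
  {within `[a, b], continuous g} <->
  forall x, a <= x <= b -> forall e, 0 < e -> exists2 r : R, 0 < r &
    forall t, a <= t <= b -> `|x - t| < r -> enorm (g x - g t) < e.
Proof.
have n0 : 0 < (n%:R + 1 : R) by rewrite ltr_wpDl.
split.
  move=> /subspace_continuousP cg x axb e e0.
  have xab : `[a, b]%classic x by rewrite /= in_itv/=.
  have /cvgrPdist_lt/(_ _ (divr_gt0 e0 n0)) := cg x xab.
  rewrite near_withinE => /nbhs_ballP[r /= r0 H]; exists r => // t atb xt.
  apply: le_lt_trans (enorm_le_normr _) _.
  have tab : `[a, b]%classic t by rewrite /= in_itv/=.
  have := H t xt tab; rewrite ltr_pdivlMr// mulrC => /(le_lt_trans _); apply.
  by rewrite ler_wpM2r// lerDl.
move=> H; apply/subspace_continuousP => x /=; rewrite in_itv/= => axb.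
apply/cvgrPdist_lt => e e0; rewrite near_withinE; apply/nbhs_ballP.
have [r r0 Hr] := H x axb e e0; exists r => //= t xt; rewrite in_itv/= => atb.
by apply: le_lt_trans (normr_le_enorm _) _; exact: Hr.
Qed.

(** Uniform continuity from compactness, in near-covering form: [P q t] holds near each point for
    all large [q], so one [q] serves every [t]. The grid lets a first exit time be replaced by a
    least natural number. *)
Lemma unif_grid (R : realType) (n : nat) (g : R -> 'rV[R]_n) (e : R) :
  {within `[0, 1], continuous g} -> 0 < e ->
  exists2 q : nat, (0 < q)%N & forall i t, (i < q)%N ->
    i%:R / q%:R <= t <= i.+1%:R / q%:R -> enorm (g t - g (i%:R / q%:R)) < e.
Proof.
move=> /within_itv_continuousP cg e0.
have e20 : 0 < e / 2 by rewrite divr_gt0.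
pose P (q : nat) (t : R) := 0 <= t <= 1 -> forall t', 0 <= t' <= 1 ->
  `|t - t'| <= q.+1%:R^-1 -> enorm (g t' - g t) < e.
have /compact_near_coveringP := @segment_compact R 0 1.
move=> /(_ nat \oo P _) near01.
have H (x : R) : `[0, 1]%classic x -> \forall x' \near x & i \near \oo, P i x'.
  rewrite /= in_itv/= => Kx; have [r r0 xr] := cg x Kx _ e20.
  exists (ball x (r / 2), [set q | q.+1%:R^-1 < r / 2]) => /=.
    split; first by apply: nbhsx_ballx; rewrite divr_gt0.
    have := near_infty_natSinv_lt (PosNum (divr_gt0 r0 (ltr0Sn R 1))).
    by apply: filterS.
  move=> [t q] /= [xt qr] t01 t' t01' tt'.
  rewrite (splitr e) (le_lt_trans (enorm_triangle (g x) _ _))// ltrD//.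
    rewrite enormB xr//; move: xt; rewrite /ball/= => xt.
    apply: le_lt_trans (ler_distD t _ _) _; rewrite (splitr r) ltrD//.
    exact: le_lt_trans qr.
  by rewrite xr//; apply: lt_trans xt _; rewrite gtr_pMr// invf_lt1// ltr1n.
have [N _ /(_ N (leqnn _)) /= HN] := near01 H.
exists N.+1 => // i t iN /andP[it ti].
have t0 : 0 <= t by rewrite (le_trans _ it)// divr_ge0.
have t1 : t <= 1 by rewrite (le_trans ti)// ler_pdivrMr// mul1r ler_nat.
have i01 : 0 <= (i%:R / N.+1%:R : R) <= 1.
  by rewrite divr_ge0//= ler_pdivrMr// mul1r ler_nat ltnW.
apply: (HN (i%:R / N.+1%:R)); rewrite /= ?in_itv/= ?i01 ?t0 ?t1//.
rewrite distrC ger0_norm ?subr_ge0// lerBlDr (le_trans ti)//.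
by rewrite -addn1 natrD mulrDl mul1r addrC.
Qed.

(** * Self-improvement of discrete A_1 weights *)

Section SelfImprovement.
Variable R : realType.
Implicit Types (F e : nat -> R) (x y al tau A : R).

Lemma sum_blocks F a q L : \sum_(a <= k < a + q * L) F k =
  \sum_(i < q) \sum_(a + i * L <= k < a + i * L + L) F k.
Proof.
elim: q => [|q IH]; first by rewrite mul0n addn0 big_geq// big_ord0.
rewrite big_ord_recr/= -IH mulSn [(L + _)%N]addnC addnA.
by rewrite (@big_cat_nat _ _ _ (a + q * L)) ?leq_addr.
Qed.

(* The share of the total weight carried by a block of length [L], among [M], on
   which [e >= L]. Such a block exists once [M] is large: otherwise [e <= 3 L]
   throughout and the total weight would exceed [A (M L)^al]. *)
Definition gain (M : nat) A : R := (3 * M%:R * A)^-1.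

(** Passing from length [L] to [M L] loses a factor [M^(al - tau)]. It is regained on a block where
    [e >= L]: there [e^(tau - al) <= L^(tau - al)], so the constant 1 replaces the inductive 2, and
    since this block carries a share [gain M A] of the total, the overall constant drops to
    [2 - gain M A]. The hypothesis relating [M], [tau] and the gain says that the two effects
    balance. *)
Lemma improve_step al A tau (M : nat) L e a : 0 < al < 1 -> 1 <= A -> (0 < M)%N ->
  A < (M%:R / 3) `^ (1 - al) -> tau <= al ->
  M%:R `^ (al - tau) * (2 - gain M A) <= 2 ->
  (0 < L)%N -> (forall k, 1 <= e k) ->
  (forall k l, (k <= l)%N -> `|e k - e l| <= 2 * (l - k)%:R) ->
  \sum_(a <= k < a + M * L) e k `^ (al - 1) <= A * (M * L)%:R `^ al ->
  (forall i, (i < M)%N ->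
     \sum_(a + i * L <= k < a + i * L + L) e k `^ (tau - 1) <=
     2 * L%:R `^ (tau - al) * \sum_(a + i * L <= k < a + i * L + L) e k `^ (al - 1)) ->
  \sum_(a <= k < a + M * L) e k `^ (tau - 1) <=
  2 * (M * L)%:R `^ (tau - al) * \sum_(a <= k < a + M * L) e k `^ (al - 1).
Proof.
move=> /andP[al0 al1] A1 M0 AM tal Mgain L0 e1 elip WA IH.
have e0 k : 0 < e k by apply: lt_le_trans (e1 k).
have A0 : 0 < A by apply: lt_le_trans A1.
have M0' : 0 < M%:R :> R by rewrite ltr0n.
have L0' : 0 < L%:R :> R by rewrite ltr0n.
have N0' : 0 < (M * L)%:R :> R by rewrite ltr0n muln_gt0 M0.
have c0 : 0 < gain M A by rewrite invr_gt0 !mulr_gt0.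
have M1 : 1 <= M%:R :> R by rewrite ler1n.
have c1 : gain M A <= 1.
  rewrite invf_le1 ?mulr_gt0//; nra.
have tal0 : tau - al <= 0 by rewrite subr_le0.
have al10 : al - 1 <= 0 by rewrite subr_le0 ltW.
set W := \sum_(a <= k < a + M * L) e k `^ (al - 1) in WA *.
have W0 : 0 <= W by apply: sumr_ge0 => k _; exact: powR_ge0.
have LN : L%:R `^ (tau - al) = (M * L)%:R `^ (tau - al) * M%:R `^ (al - tau).
  rewrite natrM powRM ?ltW// mulrAC -powRD; last by rewrite (gt_eqF M0') implybT.
  by rewrite (_ : tau - al + (al - tau) = 0) ?powRr0 ?mul1r//; ring.
have LNle : (2 - gain M A) * L%:R `^ (tau - al) <= 2 * (M * L)%:R `^ (tau - al).
  rewrite LN mulrCA [leRHS]mulrC ler_wpM2l ?powR_ge0//.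
  by rewrite mulrC.
have split_pow k : e k `^ (tau - 1) = e k `^ (tau - al) * e k `^ (al - 1).
  rewrite -powRD; last by rewrite (gt_eqF (e0 k)) implybT.
  by congr (_ `^ _); ring.
have goodblock b : (forall k, (b <= k < b + L)%N -> L%:R <= e k) ->
   \sum_(b <= k < b + L) e k `^ (tau - 1) <=
   L%:R `^ (tau - al) * \sum_(b <= k < b + L) e k `^ (al - 1).
  move=> gb; rewrite mulr_sumr !big_nat; apply: ler_sum => k kb.
  by rewrite split_pow ler_wpM2r ?powR_ge0// le_powR_neg// gb.
(* If [e >= L] throughout, the constant 1 is available everywhere. Otherwise one value below [L] and
   slope 2 bound [e] by [L + 2 M L <= 3 M L]. *)
have [allL|] := pselect (forall k, (a <= k < a + M * L)%N -> L%:R <= e k).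
  apply: (@le_trans _ _ (L%:R `^ (tau - al) * W)).
    rewrite mulr_sumr !big_nat; apply: ler_sum => k kb.
    by rewrite split_pow ler_wpM2r ?powR_ge0// le_powR_neg// allL.
  rewrite ler_wpM2r// (le_trans _ LNle)// ler_peMl ?powR_ge0//; lra.
move=> /existsNP[k0 /not_implyP[/andP[ak0 k0a] /negP]]; rewrite -ltNge => ek0.
have e3 k : (a <= k < a + M * L)%N -> e k <= 3 * (M * L)%:R.
  move=> /andP[ak ka].
  have LM : L%:R <= (M * L)%:R :> R by rewrite ler_nat leq_pmull.
  have [kk0|k0k] := leqP k k0.
    have := elip _ _ kk0; rewrite ler_norml => /andP[_].
    have : (k0 - k)%:R <= (M * L)%:R :> R by rewrite ler_nat; clear -ak k0a; lia.
    lra.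
  have := elip _ _ (ltnW k0k); rewrite ler_norml => /andP[+ _].
  have : (k - k0)%:R <= (M * L)%:R :> R by rewrite ler_nat; clear -ak0 ka; lia.
  lra.
have [i0 i0M good0] : exists2 i, (i < M)%N &
    forall k, (a + i * L <= k < a + i * L + L)%N -> L%:R <= e k.
  apply: contrapT => nogood.
  have e3L k : (a <= k < a + M * L)%N -> e k <= 3 * L%:R.
    move=> /andP[ak ka]; pose i := ((k - a) %/ L)%N.
    have iM : (i < M)%N by rewrite ltn_divLR//; clear -ak ka L0; lia.
    have kk : (a + i * L <= k < a + i * L + L)%N.
      by have := divn_eq (k - a) L; have := ltn_pmod (k - a) L0; rewrite -/i; clear -ak; lia.
    have : ~ forall k, (a + i * L <= k < a + i * L + L)%N -> L%:R <= e k.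
      by move=> H; apply: nogood; exists i.
    move=> /existsNP[l /not_implyP[ll /negP]]; rewrite -ltNge => el.
    have [kl|lk] := leqP k l.
      have := elip _ _ kl; rewrite ler_norml => /andP[_].
      have : (l - k)%:R <= L%:R :> R by rewrite ler_nat; clear -ll kk; lia.
      lra.
    have := elip _ _ (ltnW lk); rewrite ler_norml => /andP[+ _].
    have : (k - l)%:R <= L%:R :> R by rewrite ler_nat; clear -ll kk; lia.
    lra.
  have : (M * L)%:R * (3 * L%:R) `^ (al - 1) <= W.
    rewrite -[X in X%:R * _](addKn a); apply: sum_ge_const => k kb.
    by rewrite le_powR_neg// e3L.
  have -> : (M * L)%:R * (3 * L%:R) `^ (al - 1) = (M%:R / 3) `^ (1 - al) * (M * L)%:R `^ al.
    have -> : 3 * L%:R = (M * L)%:R * (M%:R / 3)^-1 :> R.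
      by rewrite natrM; field; rewrite gt_eqF.
    rewrite powRM ?ltW ?invr_gt0 ?divr_gt0// -powR_inv1 ?ltW ?divr_gt0//.
    rewrite -powRrM mulN1r opprB mulrA mulrC; congr (_ * _).
    exact: mul_powRB1.
  move=> /le_trans/(_ WA); rewrite ler_pM2r ?powR_gt0//.
  by rewrite leNgt AM.
pose Wi i := \sum_(a + i * L <= k < a + i * L + L) e k `^ (al - 1).
have WE : W = Wi i0 + \sum_(i < M | i != Ordinal i0M) Wi i.
  by rewrite /W sum_blocks (bigD1 (Ordinal i0M)).
(* The block contributes at least [L (3 M L)^(al - 1)], the total is at most [A (M L)^al], and
   [3^(al - 1) >= 1/3]; the quotient is the gain. *)
have Wi0 : gain M A * W <= Wi i0.
  apply: (@le_trans _ _ (L%:R * (3 * (M * L)%:R) `^ (al - 1))); last first.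
    rewrite -[X in X%:R * _](addKn (a + i0 * L)%N); apply: sum_ge_const => k kb.
    rewrite le_powR_neg// e3//.
    by clear -kb i0M; nia.
  apply: (@le_trans _ _ (gain M A * (A * (M * L)%:R `^ al))).
    by rewrite ler_wpM2l// ltW.
  have -> : gain M A * (A * (M * L)%:R `^ al) = L%:R * (3^-1 * (M * L)%:R `^ (al - 1)).
    rewrite /gain -(mul_powRB1 al N0') natrM; field.
    by rewrite !gt_eqF.
  rewrite ler_wpM2l ?(ltW L0')// powRM ?ler0n// ler_wpM2r ?powR_ge0//.
  by rewrite -powR_inv1// ler_powR//; lra.
rewrite sum_blocks (bigD1 (Ordinal i0M))//=.
apply: (@le_trans _ _ (L%:R `^ (tau - al) * Wi i0 +
   \sum_(i < M | i != Ordinal i0M) 2 * L%:R `^ (tau - al) * Wi i)).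
  by apply: lerD; [exact: goodblock | apply: ler_sum => i _; exact: IH].
rewrite -mulr_sumr.
set S := \sum_(_ < _ | _) _ in WE *.
apply: (@le_trans _ _ ((2 - gain M A) * L%:R `^ (tau - al) * W)); last first.
  by rewrite ler_wpM2r.
have l0 := powR_ge0 (L%:R : R) (tau - al).
rewrite [X in X + _]mulrC -[2 * _ * _]mulrA [L%:R `^ _ * S]mulrC mulrA -mulrDl.
by rewrite mulrAC ler_wpM2r//; move: Wi0; rewrite WE; lra.
Qed.

Lemma self_improvement al A : 0 < al < 1 -> 1 <= A ->
  exists als B, 0 < als < al /\ 0 < B /\
  forall (p : nat) e, (0 < p)%N -> (forall k, 1 <= e k) ->
  (forall k l, (k <= l)%N -> `|e k - e l| <= 2 * (l - k)%:R) ->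
  (forall i j, (i < j <= p)%N ->
     \sum_(i <= k < j) e k `^ (al - 1) <= A * (j - i)%:R `^ al) ->
  forall tau, als <= tau <= al ->
  \sum_(0 <= k < p) e k `^ (tau - 1) <= B * p%:R `^ tau.
Proof.
move=> al01 A1; have [al0 al1] := andP al01.
have A0 : 0 < A by apply: lt_le_trans A1.
(* Any [M > 3 A^(1 / (1 - al))] forces a block with [e >= L]; the [.+2] also makes [M > 1], so that
   powers of [M] grow. *)
pose M := (Num.truncn (3 * (A `^ (1 - al)^-1 + 1))).+2.
have AM : A < (M%:R / 3) `^ (1 - al).
  have : A `^ (1 - al)^-1 < M%:R / 3.
    rewrite ltr_pdivlMr// mulrC.
    have : 3 * (A `^ (1 - al)^-1 + 1) < M%:R.
      apply: lt_trans (truncnS_gt _) _; by rewrite ltr_nat.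
    lra.
  have al1' : 0 < 1 - al by rewrite subr_gt0.
  move=> /(gt0_ltr_powR al1'); rewrite !nnegrE powR_ge0 divr_ge0// => /(_ isT isT).
  by rewrite -powRrM mulVf ?gt_eqF// powRr1// ltW.
have M0 : (0 < M)%N by [].
have M2 : (1 < M)%N by [].
have M1 : 1 < M%:R :> R by rewrite ltr1n.
clearbody M.
have c0 : 0 < gain M A by rewrite invr_gt0 !mulr_gt0// ltr0n.
have c1 : gain M A <= 1 by rewrite invf_le1 ?mulr_gt0 ?ltr0n//; nra.
have lnM : 0 < ln (M%:R : R) by rewrite ln_gt0.
(* The loss [M^(al - tau)] must not exceed [rho], that is [al - tau <= ln rho / ln M]; the bound
   [al / 2] keeps the new exponent positive. *)
pose rho := 2 / (2 - gain M A).
have rho1 : 1 < rho by rewrite ltr_pdivlMr; lra.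
pose d := Num.min (al / 2) (ln rho / ln M%:R).
have d0 : 0 < d by rewrite lt_min !divr_gt0// ln_gt0.
have dal : d < al by rewrite gt_min; apply/orP; left; move: al0; lra.
(* With [L] the largest power of [M] not above [p], the indices below [p] are covered by at most [M]
   consecutive blocks of length [L] and one block ending at [p], each contributing at most
   [2 A p^tau]. *)
exists (al - d), (2 * A * (M%:R + 1)); split; first by apply/andP; split; lra.
split; first by rewrite !mulr_gt0//; lra.
move=> p e p0 e1 elip WA tau /andP[ttau taual].
have e0 k : 0 < e k by apply: lt_le_trans (e1 k).
have tau0 : 0 < tau by move: ttau; lra.
have Mgain : M%:R `^ (al - tau) * (2 - gain M A) <= 2.
  rewrite -ler_pdivlMr; last by lra.
  apply: (@le_trans _ _ (M%:R `^ (ln rho / ln M%:R))).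
    rewrite ler_powR ?(ltW M1)//.
    apply: (@le_trans _ _ d); first by lra.
    by rewrite ge_min lexx orbT.
  rewrite /powR gt_eqF; last exact: lt_trans M1.
  by rewrite divfK ?gt_eqF// lnK// posrE; lra.
have claim j a : (a + M ^ j <= p)%N ->
    \sum_(a <= k < a + M ^ j) e k `^ (tau - 1) <=
    2 * (M ^ j)%:R `^ (tau - al) * \sum_(a <= k < a + M ^ j) e k `^ (al - 1).
  elim: j a => [|j IH] a aj.
    rewrite expn0 addn1 !big_nat1 powR1 mulr1.
    apply: (@le_trans _ _ (e a `^ (al - 1))); first by rewrite ler_powR//; lra.
    by rewrite ler_peMl ?powR_ge0// ler1n.
  rewrite expnS in aj *; apply: (improve_step al01 A1) => //.
  - by rewrite expn_gt0 M0.
  - have := WA a (a + M * M ^ j)%N; rewrite addKn; apply.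
    by rewrite aj andbT -[X in (X < _)%N]addn0 ltn_add2l muln_gt0 M0 expn_gt0 M0.
  - move=> i iM; apply: IH; apply: leq_trans aj.
    by rewrite -addnA leq_add2l addnC -mulSn leq_mul2r iM orbT.
pose L := (M ^ trunc_log M p)%N.
have Lp : (L <= p)%N by apply: trunc_logP.
have pL : (p < M * L)%N by rewrite -expnS; apply: trunc_log_ltn.
have L0 : (0 < L)%N by rewrite expn_gt0 M0.
have := claim (trunc_log M p); rewrite -/L => {}claim; clearbody L.
have block a : (a + L <= p)%N ->
    \sum_(a <= k < a + L) e k `^ (tau - 1) <= 2 * A * p%:R `^ tau.
  move=> ap; apply: le_trans (claim _ ap) _.
  apply: (@le_trans _ _ (2 * L%:R `^ (tau - al) * (A * L%:R `^ al))).
    rewrite ler_wpM2l ?mulr_ge0 ?powR_ge0//.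
    by have := WA a (a + L)%N; rewrite addKn; apply; rewrite ap andbT; clear -L0; lia.
  rewrite mulrACA ler_wpM2l ?mulr_ge0 ?(ltW A0)// -powRD; last first.
    by rewrite pnatr_eq0 -lt0n L0 implybT.
  rewrite subrK ge0_ler_powR ?nnegrE ?(ltW tau0)// ler_nat//.
have qM : (p %/ L <= M)%N by rewrite -ltnS ltn_divLR//; clear -pL; nia.
have := divn_eq p L; have := ltn_pmod p L0.
move: qM; move: (p %/ L)%N (p %% L)%N => q r qM rL pE.
have F0 k : 0 <= e k `^ (tau - 1) by exact: powR_ge0.
apply: (@le_trans _ _ (\sum_(0 <= k < 0 + q * L) e k `^ (tau - 1) +
          \sum_(p - L <= k < p - L + L) e k `^ (tau - 1))).
  rewrite (@big_cat_nat _ _ _ (q * L)%N)//=; last by clear -pE; lia.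
  rewrite lerD2l subnK// [leRHS](@big_cat_nat _ _ _ (q * L)%N)//=; try by clear -pE rL Lp; lia.
  by rewrite lerDr sumr_ge0.
rewrite mulrAC mulrDr mulr1 lerD//; last by apply: block; rewrite subnK.
rewrite sum_blocks.
apply: (@le_trans _ _ (\sum_(i < q) 2 * A * p%:R `^ tau)).
  by apply: ler_sum => i _; apply: block; have := ltn_ord i; clear -pE; nia.
rewrite sumr_const card_ord -[leLHS]mulr_natr ler_wpM2l ?ler_nat//.
by rewrite !mulr_ge0 ?powR_ge0// ltW.
Qed.

End SelfImprovement.

(** * Segments, curves and chains *)

Section Curves.
Variables (R : realType) (n : nat).
Local Notation V := 'rV[R]_n.

Definition segment (u v : V) (t : R) : V := u + t *: (v - u).

Lemma segment0 u v : segment u v 0 = u.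
Proof. by rewrite /segment scale0r addr0. Qed.

Lemma segment1 u v : segment u v 1 = v.
Proof. by rewrite /segment scale1r addrC subrK. Qed.

Lemma segmentB u v s t : segment u v s - segment u v t = (s - t) *: (v - u).
Proof. by apply/rowP => i; rewrite !mxE; ring. Qed.

Lemma enorm_segmentB u v s t :
  enorm (segment u v s - segment u v t) = `|s - t| * enorm (u - v).
Proof. by rewrite segmentB enormZ [in RHS]enormB. Qed.

Lemma enorm_segment_start u v t : 0 <= t <= 1 ->
  enorm (u - segment u v t) <= enorm (u - v).
Proof.
move=> /andP[t0 t1]; rewrite -{1}(segment0 u v) enorm_segmentB sub0r normrN.
by rewrite ger0_norm// ler_piMl ?enorm_ge0.
Qed.

Lemma continuous_segment u v : continuous (segment u v).
Proof.
move=> t; apply: cvgD; first exact: cvg_cst.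
by apply: cvgZr_tmp; exact: cvg_id.
Qed.

Lemma wt_ge0 (O : set V) tau z : (0 <= wt O tau z)%E.
Proof.
rewrite /wt; case: dist_bd => [r||]//; first by rewrite lee_fin powR_ge0.
by case: ifP => _; rewrite lee_fin.
Qed.

Lemma segment_lineint_le (f : V -> \bar R) (M : R) u v : 0 <= M ->
  (forall z, 0 <= f z)%E ->
  (forall t, 0 <= t <= 1 -> (f (segment u v t) <= M%:E)%E) ->
  (lineint (segment u v) 0 1 f <= (M * enorm (u - v))%:E)%E.
Proof.
move=> M0 f0 fM.
have := @lineint_segment_le R n (segment u v) f M 1 0 u (v - u) 0 1 M0 ler01 ler01 f0.
rewrite subr0 !mul1r [enorm (u - v)]enormB; apply=> // t _.
by rewrite mul1r addr0.
Qed.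

Lemma segment_length u v : (curve_length (segment u v) 0 1 <= (enorm (u - v))%:E)%E.
Proof. by rewrite -[enorm _]mul1r; apply: segment_lineint_le. Qed.

Lemma segment_rect_curve (O : set V) u v :
  (forall t, 0 <= t <= 1 -> O (segment u v t)) -> rect_curve O u v (segment u v).
Proof.
move=> sO; split; first by apply: continuous_subspaceT; exact: continuous_segment.
rewrite segment0 segment1; do !split => //.
exact: le_lt_trans (segment_length _ _) (ltry _).
Qed.

Lemma grid_cell (q j : nat) (t : R) : (0 < q)%N -> (0 < j)%N ->
  0 <= t <= j%:R / q%:R ->
  exists2 i, (i < j)%N & i%:R / q%:R <= t <= i.+1%:R / q%:R.
Proof.
move=> q0 j0 /andP[t0 tj]; have q0' : 0 < q%:R :> R by rewrite ltr0n.
have tq : 0 <= t * q%:R by rewrite mulr_ge0// ltW.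
have := truncn_itv tq; set i := Num.truncn _ => /andP[it ti].
have [ij|ji] := ltnP i j.
  by exists i => //; rewrite ler_pdivrMr// ler_pdivlMr// it ltW.
(* Only the right end [t = j / q] falls here; it is assigned to the last cell. *)
exists j.-1; first by rewrite prednK.
rewrite prednK// tj andbT ler_pdivrMr// (le_trans _ it)// ler_nat.
exact: leq_trans (leq_pred _) ji.
Qed.

End Curves.

(** * Short curves and cheap chains in a subhyperbolic domain *)

Section Subhyperbolic.
Variables (R : realType) (n : nat).
Local Notation V := 'rV[R]_n.
Variables (O : set V) (al C0 theta0 : R).
Hypotheses (al01 : 0 < al < 1) (C0_gt0 : 0 < C0) (oO : open O) (bdO : bd O !=set0).
Hypothesis sub : subhyperbolic al O C0 theta0.
Local Notation dl := (dl O).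

(** The factor 2 makes the bound on the infimum strict, so some curve achieves it; [h > 0] in place
    of the distance keeps it strict for [u = v]. *)
Lemma subhyp_curve u v h : O u -> O v -> enorm (u - v) <= h -> h <= theta0 -> 0 < h ->
  exists2 g, rect_curve O u v g &
    (lineint g 0 1 (wt O al) <= (2 * C0 * h `^ al)%:E)%E.
Proof.
move=> Ou Ov uvh ht h0; have [_ [_ H]] := sub; have [al0 al1] := andP al01.
have : (subhyp_dist al O u v < (2 * C0 * h `^ al)%:E)%E.
  apply: le_lt_trans (H _ _ Ou Ov (le_trans uvh ht)) _; rewrite lte_fin.
  apply: (@le_lt_trans _ _ (C0 * h `^ al)).
    by rewrite ler_wpM2l ?(ltW C0_gt0)// ge0_ler_powR ?nnegrE ?enorm_ge0 ?(ltW al0) ?(ltW h0).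
  by rewrite ltr_pM2r ?powR_gt0//; have := C0_gt0; lra.
by move=> /ereal_inf_lt[_ [g gr <-] /ltW gle]; exists g.
Qed.

Lemma exists_large_ratio (c : R) : 0 < c ->
  exists2 Q : R, 5 <= Q & c < (Q - 3) * Q `^ (al - 1).
Proof.
move=> c0; have [al0 al1] := andP al01.
have b0 : 1 <= 5 * c + 5 by lra.
(* Here [Q^al = 5 c + 5], and [Q - 3 >= 2 Q / 5] for [Q >= 5], so the product is at least
   [2 c + 2]. *)
exists ((5 * c + 5) `^ al^-1).
  apply: (@le_trans _ _ ((5 * c + 5) `^ 1)); first by rewrite powRr1; lra.
  by rewrite ler_powR// -invr1 lef_pV2 ?posrE// ltW.
set Q := _ `^ _.
have Q5 : 5 <= Q.
  apply: (@le_trans _ _ ((5 * c + 5) `^ 1)); first by rewrite powRr1; lra.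
  by rewrite ler_powR// -invr1 lef_pV2 ?posrE// ltW.
have Q0 : 0 < Q by lra.
have : Q * Q `^ (al - 1) = 5 * c + 5.
  rewrite mul_powRB1// /Q -powRrM mulVf ?gt_eqF// powRr1//; lra.
have := powR_gt0 (al - 1) Q0; nra.
Qed.

Let wt_dl tau z : wt O tau z = (dl z `^ (tau - 1))%:E.
Proof. exact: wtE. Qed.

(** Up to the first grid point with [dl > (Q - 1) h] the weight is at least [(Q h)^(al - 1)], and
    the curve has moved by at least [(Q - 1) h - 2 h]. This costs more than [2 C0 h^al] by the
    choice of [Q]. *)
Lemma curve_stays_close u v g h (Q : R) : O u -> 0 < h -> dl u < 2 * h -> 5 <= Q ->
  2 * C0 < (Q - 3) * Q `^ (al - 1) ->
  rect_curve O u v g -> (lineint g 0 1 (wt O al) <= (2 * C0 * h `^ al)%:E)%E ->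
  forall t, 0 <= t <= 1 -> dl (g t) <= Q * h.
Proof.
move=> Ou h0 du Q5 Qbig [cg [g0 [g1 [gO _]]]] gle t /andP[t0 t1].
have [al0 al1] := andP al01.
rewrite leNgt; apply/negP => dt.
have [q q0 gq] := unif_grid cg h0.
have q0' : 0 < q%:R :> R by rewrite ltr0n.
have [i iq ti] : exists2 i, (i < q)%N & i%:R / q%:R <= t <= i.+1%:R / q%:R.
  by apply: grid_cell => //; rewrite t0 divff ?gt_eqF.
(* The curve varies by less than [h] within a cell, which explains [Q - 1] at grid points against
   [Q] in between. *)
have exj : exists j, (j <= q)%N && ((Q - 1) * h < dl (g (j%:R / q%:R))).
  exists i; rewrite (ltnW iq)/=; have := gq _ _ iq ti.
  have := dl_lip bdO (g t) (g (i%:R / q%:R)); lra.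
case: (ex_minnP exj) => j /andP[jq dj] jmin.
have j0 : (0 < j)%N.
  by rewrite lt0n; apply/eqP => j0; move: dj; rewrite j0 mul0r g0; nra.
have before s : 0 <= s <= j%:R / q%:R -> dl (g s) <= Q * h.
  move=> sj; have [k kj sk] := grid_cell q0 j0 sj.
  have kq : (k < q)%N by apply: leq_trans jq.
  have := gq _ _ kq sk.
  have := dl_lip bdO (g s) (g (k%:R / q%:R)).
  have : dl (g (k%:R / q%:R)) <= (Q - 1) * h.
    rewrite leNgt; apply/negP => dk.
    by have := jmin k; rewrite (ltnW kq) dk leqNgt kj => /(_ isT).
  lra.
have jq1 : j%:R / q%:R <= 1 :> R by rewrite ler_pdivrMr// mul1r ler_nat.
have jq0 : 0 <= j%:R / q%:R :> R by rewrite divr_ge0.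
have Qh0 : 0 < Q * h by rewrite mulr_gt0//; lra.
have : ((Q * h) `^ (al - 1) * enorm (g (j%:R / q%:R) - g 0) <= 2 * C0 * h `^ al).
  rewrite -lee_fin; apply: le_trans gle.
  apply: le_trans (lineint_sub g (lexx 0) jq0 jq1 (@wt_ge0 _ _ O al)).
  apply: chord_le_lineint => // s sj; rewrite wt_dl lee_fin.
  have s1 : 0 <= s <= 1 by case/andP: sj => -> /= /le_trans; apply.
  rewrite le_powR_neg ?before//; last by lra.
  exact: dl_gt0 (gO _ s1).
have : (Q - 3) * h <= enorm (g (j%:R / q%:R) - g 0).
  have := dl_lip bdO (g (j%:R / q%:R)) (g 0); rewrite g0; lra.
rewrite powRM ?(ltW h0)//; last by lra.
rewrite -(mul_powRB1 al h0).
have hp := powR_gt0 (al - 1) h0.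
have Q0 : 0 < Q by lra.
have Qp := powR_gt0 (al - 1) Q0.
move=> l1 l2.
have : (Q `^ (al - 1) * h `^ (al - 1)) * ((Q - 3) * h) <= 2 * C0 * (h * h `^ (al - 1)).
  by apply: le_trans l2; rewrite ler_wpM2l// mulr_ge0 ?powR_ge0.
rewrite (_ : _ * _ * _ = (Q - 3) * Q `^ (al - 1) * (h * h `^ (al - 1))); last by ring.
by rewrite ler_pM2r ?mulr_gt0// leNgt Qbig.
Qed.

(** Subhyperbolicity bounds cost, not length. Far from the boundary a segment controls both; near it
    the curve stays within [Q h] of the boundary, so its length is at most [(Q h)^(1 - al)] times
    its cost. These curves will replace the steps that are not kept. *)
Lemma exists_short_curve (Q : R) u v h : 5 <= Q ->
  2 * C0 < (Q - 3) * Q `^ (al - 1) ->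
  O u -> O v -> enorm (u - v) <= h -> h <= theta0 -> 0 < h ->
  exists g, [/\ rect_curve O u v g,
    (curve_length g 0 1 <= ((1 + 2 * C0 * Q) * h)%:E)%E &
    (lineint g 0 1 (wt O al) <= ((1 + 2 * C0 * Q) * h `^ al)%:E)%E].
Proof.
move=> Q5 Qbig Ou Ov uvh ht h0; have [al0 al1] := andP al01.
have Q0 : 0 < Q by lra.
have [du|du] := leP (2 * h) (dl u).
  have sO t : 0 <= t <= 1 -> O (segment u v t).
    move=> t01; apply: (dl_ball bdO Ou).
    by apply: le_lt_trans (enorm_segment_start _ _ t01) _; lra.
  exists (segment u v); split; first exact: segment_rect_curve.
    apply: le_trans (segment_length _ _) _; rewrite lee_fin (le_trans uvh)//.
    by rewrite ler_peMl ?(ltW h0)// lerDl !mulr_ge0 ?(ltW C0_gt0) ?(ltW Q0).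
  apply: (@le_trans _ _ (h `^ (al - 1) * enorm (u - v))%:E).
    apply: segment_lineint_le; [exact: powR_ge0|exact: wt_ge0|move=> t t01].
    rewrite wt_dl lee_fin le_powR_neg//; last by lra.
    have := dl_lip bdO u (segment u v t); have := enorm_segment_start u v t01.
    by lra.
  rewrite lee_fin -(mul_powRB1 al h0).
  have := powR_gt0 (al - 1) h0; set P := h `^ _ => P0.
  apply: (@le_trans _ _ (P * h)); first by rewrite ler_wpM2l// ltW.
  by rewrite [P * h]mulrC ler_peMl ?mulr_ge0 ?(ltW h0) ?(ltW P0)// lerDl !mulr_ge0 ?(ltW C0_gt0) ?(ltW Q0).
have [g gr gle] := subhyp_curve Ou Ov uvh ht h0.
have close := curve_stays_close Ou h0 du Q5 Qbig gr gle.
have [_ [_ [_ [gO _]]]] := gr.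
exists g; split => //; last first.
  apply: le_trans gle _; rewrite lee_fin ler_wpM2r ?powR_ge0//.
  rewrite (@le_trans _ _ (2 * C0 * Q)) ?lerDr ?ler_peMr ?mulr_ge0 ?(ltW C0_gt0)//.
  by lra.
have Qh0 : 0 < Q * h by rewrite mulr_gt0.
have c0 : 0 < (Q * h) `^ (al - 1) by rewrite powR_gt0.
apply: le_trans (length_le_lineint c0 ler01 _ (@wt_ge0 _ _ O al)) _.
  move=> t t01; rewrite wt_dl lee_fin le_powR_neg ?close//; last by lra.
  exact: dl_gt0 (gO _ t01).
apply: le_trans (lee_wpmul2l _ gle) _; first by rewrite lee_fin invr_ge0 ltW.
rewrite -EFinM lee_fin -powRN opprB mulrCA powRM ?(ltW h0) ?(ltW Q0)//.
have -> : 2 * C0 * (Q `^ (1 - al) * h `^ (1 - al) * h `^ al) = 2 * C0 * Q `^ (1 - al) * h.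
  rewrite -!mulrA -powRD_gt0// subrK powRr1 ?ltW//.
have : Q `^ (1 - al) <= Q.
  rewrite -{2}[Q]powRr1 ?(ltW Q0)// ler_powR; lra.
move=> Qle; rewrite [leRHS]mulrDl mul1r; apply: (@le_trans _ _ (2 * C0 * Q * h)).
  by rewrite ler_wpM2r ?(ltW h0)// ler_wpM2l ?mulr_ge0 ?(ltW C0_gt0).
by rewrite lerDr ltW.
Qed.

Section Chains.
Variable sg : R.
Hypothesis sg0 : 0 < sg.

Definition chain (u v : V) (p : seq V) : Prop :=
  [/\ path (fun a b => enorm (a - b) <= sg) u p, last u p = v &
      forall z, z \in p -> O z].

(* Truncating the distance at the step size keeps the cost of a step bounded, so
   that near-minimal chains already satisfy scale-invariant estimates. *)
Definition tdl (z : V) : R := Num.max (dl z) sg.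

(** A step is charged the full [sg], at its starting point, whatever its actual length. Deleting an
    interior point then saves one charge, and bounds on cost become bounds on numbers of steps. *)
Definition cost (u : V) (p : seq V) : R :=
  \sum_(z <- belast u p) sg * tdl z `^ (al - 1).

Lemma tdl_gt0 z : 0 < tdl z.
Proof. by rewrite /tdl lt_max sg0 orbT. Qed.

Lemma cost_cons u v p : cost u (v :: p) = sg * tdl u `^ (al - 1) + cost v p.
Proof. by rewrite /cost /= big_cons. Qed.

Lemma cost_nil u : cost u [::] = 0.
Proof. by rewrite /cost /= big_nil. Qed.

Lemma step_cost_ge0 z : 0 <= sg * tdl z `^ (al - 1).
Proof. by rewrite mulr_ge0 ?powR_ge0// ltW. Qed.

Lemma cost_ge0 u p : 0 <= cost u p.
Proof. by apply: sumr_ge0 => z _; exact: step_cost_ge0. Qed.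

Lemma cost_cat u p q : cost u (p ++ q) = cost u p + cost (last u p) q.
Proof. by rewrite /cost belast_cat big_cat. Qed.

Lemma step_cost_le z : sg * tdl z `^ (al - 1) <= sg `^ al.
Proof.
have [al0 al1] := andP al01.
rewrite -(mul_powRB1 al sg0) ler_wpM2l ?(ltW sg0)// le_powR_neg//.
  by rewrite /tdl le_max lexx orbT.
by lra.
Qed.

(** The chain samples the curve each time it has moved by [sg / 2]. Between two samples it stays
    within [sg] of the first one, [w], so [dl <= 2 * tdl w] there, and the piece costs at least
    [2^(al - 1) >= 1/2] times [tdl w^(al - 1) * (sg / 2)], a quarter of the step's charge. Four
    times [2 C0 h^al] plus the last step gives [8 C0 + 1]. *)
Lemma chain_of_curve u v h : O u -> O v -> enorm (u - v) <= h -> h <= theta0 ->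
  sg <= h -> exists2 p, chain u v p & cost u p <= (8 * C0 + 1) * h `^ al.
Proof.
move=> Ou Ov uvh ht sgh; have [al0 al1] := andP al01.
have h0 : 0 < h by apply: lt_le_trans sgh.
have [g [cg [g0 [g1 [gO _]]]] gle] := subhyp_curve Ou Ov uvh ht h0.
have sg20 : 0 < sg / 2 by rewrite divr_gt0.
have [q q0 gq] := unif_grid cg sg20.
have q0' : 0 < q%:R :> R by rewrite ltr0n.
have qq : q%:R / q%:R = 1 :> R by rewrite divff ?gt_eqF.
have in01 i : (i <= q)%N -> 0 <= (i%:R / q%:R : R) <= 1.
  by move=> iq; rewrite divr_ge0//= ler_pdivrMr// mul1r ler_nat.
have wt0 := @wt_ge0 _ _ O al.
(* The sampling runs over grid indices, by induction on how many remain; the term [sg^al] pays for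
   the last step, which may move by less than [sg / 2]. *)
suff H k i : (q - i <= k)%N -> (i <= q)%N -> exists2 p, chain (g (i%:R / q%:R)) v p &
    ((cost (g (i%:R / q%:R)) p)%:E <=
      4%:E * lineint g (i%:R / q%:R) 1 (wt O al) + (sg `^ al)%:E)%E.
  have [p] := H q 0%N (leq_subr _ _) (leq0n _).
  rewrite mul0r g0 => cp costp; exists p => //; rewrite -lee_fin.
  apply: le_trans costp _.
  apply: (@le_trans _ _ (4%:E * (2 * C0 * h `^ al)%:E + (sg `^ al)%:E)%E).
    by rewrite leeD2r// lee_wpmul2l.
  rewrite -EFinM -EFinD lee_fin.
  have : sg `^ al <= h `^ al by rewrite ge0_ler_powR ?nnegrE// ltW.
  lra.
elim: k i => [|k IH] i.
  rewrite leqn0 subn_eq0 => qi iq.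
  have {iq qi}-> : i = q by apply/eqP; rewrite eqn_leq iq.
  exists [:: v]; rewrite qq.
    by split; rewrite /= ?g1 ?subrr ?enorm0 ?(ltW sg0)// => z; rewrite inE => /eqP->.
  rewrite cost_cons cost_nil addr0 lineint_refl mule0 add0e lee_fin.
  exact: step_cost_le.
move=> iqk iq.
(* The next sample is the least later index at distance at least [sg / 2]; if there is none, one
   step reaches [v]. *)
have [exj|noj] := pselect (exists j, [&& (i < j)%N, (j <= q)%N &
    sg / 2 <= enorm (g (j%:R / q%:R) - g (i%:R / q%:R))]); last first.
  exists [:: v].
    split; rewrite /= ?andbT//; last by move=> z; rewrite inE => /eqP->.
    move: iq; rewrite leq_eqVlt => /orP[/eqP->|iq].
      by rewrite qq g1 subrr enorm0 ltW.
    rewrite leNgt; apply/negP => big; apply: noj; exists q.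
    by rewrite iq leqnn qq g1 enormB; lra.
  rewrite cost_cons cost_nil addr0 addeC.
  apply: (@le_trans _ _ (sg `^ al)%:E); first by rewrite lee_fin step_cost_le.
  by rewrite leeDl// mule_ge0// lineint_ge0//; case/andP: (in01 _ iq).
case: (ex_minnP exj) => j /and3P[ij jq far] jmin.
have near l : (i <= l < j)%N -> enorm (g (l%:R / q%:R) - g (i%:R / q%:R)) < sg / 2.
  move=> /andP[il lj]; move: il; rewrite leq_eqVlt => /orP[/eqP<-|il].
    by rewrite subrr enorm0.
  rewrite ltNge; apply/negP => big; have := jmin l.
  by rewrite il (leq_trans (ltnW lj) jq) big leqNgt lj => /(_ isT).
have ij' : i%:R / q%:R <= j%:R / q%:R :> R by rewrite ler_pM2r ?invr_gt0// ler_nat ltnW.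
have near_t t : i%:R / q%:R <= t <= j%:R / q%:R -> enorm (g t - g (i%:R / q%:R)) < sg.
  move=> /andP[it tj].
  have j0 : (0 < j)%N by apply: leq_ltn_trans ij.
  have t0 : 0 <= t by apply: le_trans it; case/andP: (in01 _ iq).
  have [l lj /andP[lt tl]] := grid_cell q0 j0 (introT andP (conj t0 tj)).
  have lq : (l < q)%N by apply: leq_trans jq.
  have gl := gq _ _ lq (introT andP (conj lt tl)).
  have [il|li] := leqP i l.
    have nl : enorm (g (l%:R / q%:R) - g (i%:R / q%:R)) < sg / 2 by rewrite near ?il.
    by have := enorm_triangle (g (l%:R / q%:R)) (g t) (g (i%:R / q%:R)); lra.
  have -> : t = i%:R / q%:R.
    apply/eqP; rewrite eq_le it (le_trans tl)// ler_pM2r ?invr_gt0// ler_nat//.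
  by rewrite subrr enorm0.
have [p [pp lp Op] costp] := IH j (ltac:(clear -ij iqk; lia)) jq.
have /andP[i0' i1'] := in01 _ iq; have /andP[j0' j1'] := in01 _ jq.
exists (g (j%:R / q%:R) :: p).
  split => //=.
    by rewrite pp andbT enormB ltW// near_t// ij' lexx.
  by move=> z; rewrite inE => /orP[/eqP->|/Op//]; apply: gO; exact: in01.
rewrite cost_cons EFinD.
apply: (@le_trans _ _ (4%:E * lineint g (i%:R / q%:R) (j%:R / q%:R) (wt O al) +
   (4%:E * lineint g (j%:R / q%:R) 1 (wt O al) + (sg `^ al)%:E))%E); last first.
  rewrite addeA leeD2r// -ge0_muleDr ?lineint_ge0// lee_wpmul2l//.
  exact: lineint_superadd.
rewrite leeD//.
set w := g (i%:R / q%:R) in near near_t far *.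
have : (((2 * tdl w) `^ (al - 1) * enorm (g (j%:R / q%:R) - w))%:E <=
    lineint g (i%:R / q%:R) (j%:R / q%:R) (wt O al))%E.
  apply: chord_le_lineint => // t tij; rewrite wt_dl lee_fin.
  have t01 : 0 <= t <= 1.
    by case/andP: tij => it tj; rewrite (le_trans i0' it) (le_trans tj j1').
  rewrite le_powR_neg//; last by lra.
    exact: dl_gt0 (gO _ t01).
  have := dl_lip bdO (g t) w; have := near_t _ tij.
  have : dl w <= tdl w by rewrite /tdl le_max lexx.
  have : sg <= tdl w by rewrite /tdl le_max lexx orbT.
  lra.
move=> chord.
apply: (@le_trans _ _ (4%:E * ((2 * tdl w) `^ (al - 1) * enorm (g (j%:R / q%:R) - w))%:E)%E); last first.
  by rewrite lee_wpmul2l.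
rewrite -EFinM lee_fin powRM ?(ltW (tdl_gt0 _))//.
have half : 2^-1 <= 2 `^ (al - 1) :> R.
  by rewrite -powR_inv1// ler_powR; lra.
have := powR_gt0 (al - 1) (tdl_gt0 w); set P := _ `^ _ => P0.
apply: (@le_trans _ _ (4 * (2^-1 * P * (sg / 2)))); first by lra.
rewrite ler_wpM2l// ler_pM ?mulr_ge0 ?(ltW P0) ?(ltW sg20) ?(ltW sg0)//.
by rewrite ler_wpM2r// ltW.
Qed.

End Chains.
End Subhyperbolic.

(** * Near-minimal chains *)

Section NearMinimalChain.
Variables (R : realType) (n : nat).
Local Notation V := 'rV[R]_n.
Variables (O : set V) (al C0 theta0 sg : R).
Hypotheses (al01 : 0 < al < 1) (C0_gt0 : 0 < C0) (oO : open O) (bdO : bd O !=set0).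
Hypothesis sub : subhyperbolic al O C0 theta0.
Hypothesis sg0 : 0 < sg.
Local Notation chain := (chain O sg).
Local Notation cost := (cost O al sg).
Local Notation step_cost z := (sg * tdl O sg z `^ (al - 1)).

Lemma chain_cat u w p q :
  chain u w (p ++ q) <-> chain u (last u p) p /\ chain (last u p) w q.
Proof.
split.
  move=> [+ + Opq]; rewrite cat_path last_cat => /andP[pp pq] lq.
  by split; split => // z zs; apply: Opq; rewrite mem_cat zs ?orbT.
move=> [[pp lp Op] [pq lq Oq]]; split.
- by rewrite cat_path pp.
- by rewrite last_cat.
- by move=> z; rewrite mem_cat => /orP[/Op|/Oq].
Qed.

Lemma last_take_nth (x y : V) p i : (i <= size p)%N ->
  last x (take i p) = nth y (x :: p) i.
Proof. by elim: p x i => [|a p IH] x [|i] //= ip; rewrite IH. Qed.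

Lemma cost_take (x y : V) p i : (i <= size p)%N ->
  cost x (take i p) = \sum_(0 <= k < i) step_cost (nth y (x :: p) k).
Proof.
elim: i => [|i IH] ip; first by rewrite take0 cost_nil big_geq.
rewrite (take_nth y)// -cats1 cost_cat IH ?(ltnW ip)// big_nat_recr//=.
by rewrite (last_take_nth x y (ltnW ip)) cost_cons cost_nil addr0.
Qed.

Lemma chain_splice (x y : V) p r i j : chain x y p -> (i <= j <= size p)%N ->
  chain (nth y (x :: p) i) (nth y (x :: p) j) r ->
  exists p', [/\ chain x y p', size p' = (i + size r + (size p - j))%N &
    cost x p' = cost x p - \sum_(i <= k < j) step_cost (nth y (x :: p) k)
                + cost (nth y (x :: p) i) r].
Proof.
move=> cp /andP[ij jp] cr; have ip : (i <= size p)%N by apply: leq_trans jp.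
have /chain_cat[ci _] : chain x y (take i p ++ drop i p) by rewrite cat_take_drop.
have /chain_cat[cj cdj] : chain x y (take j p ++ drop j p) by rewrite cat_take_drop.
rewrite (last_take_nth x y ip) in ci; rewrite (last_take_nth x y jp) in cdj.
have lr : last (nth y (x :: p) i) r = nth y (x :: p) j by case: cr.
exists (take i p ++ r ++ drop j p); split.
- apply/chain_cat; rewrite (last_take_nth x y ip); split => //.
  by apply/chain_cat; rewrite lr.
- by rewrite !size_cat size_drop size_takel// addnA.
rewrite !cost_cat (last_take_nth x y ip) lr (cost_take x y ip).
rewrite -[in cost x p](cat_take_drop j p) cost_cat (cost_take x y jp).
rewrite (last_take_nth x y jp) (@big_cat_nat _ _ _ i 0 j)//=; ring.
Qed.

(** The infimum of the costs may not be attained, but among chains within [sg^al] of it one of least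
    size exists. A chain no dearer than the chosen one is again within the tolerance, which gives
    the last clause. *)
Lemma near_minimal_chain x y : (exists p, chain x y p) ->
  exists p, [/\ chain x y p,
    forall p', chain x y p' -> cost x p <= cost x p' + sg `^ al &
    forall p', chain x y p' -> cost x p' <= cost x p -> (size p <= size p')%N].
Proof.
move=> [p0 cp0]; pose S := [set cost x p | p in [set p | chain x y p]].
have Slb : lbound S 0 by move=> _ [p _ <-]; exact: (cost_ge0 O al sg0).
have Sinf : has_inf S by split; [exists (cost x p0), p0 | exists 0].
have infle p : chain x y p -> inf S <= cost x p.
  by move=> cp; apply: ge_inf; [exists 0 | exists p].
have [_ [p1 cp1 <-] p1inf] := inf_adherent (powR_gt0 al sg0) Sinf.
pose P k := `[< exists p, [/\ chain x y p, size p = k & cost x p <= inf S + sg `^ al] >].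
have exP : exists k, P k by exists (size p1); apply/asboolP; exists p1; split => //; exact: ltW.
case: (ex_minnP exP) => k /asboolP[p [cp <- pinf]] kmin.
exists p; split => // [p' cp'|p' cp' p'p].
  by apply: le_trans pinf _; rewrite lerD2r infle.
by apply: kmin; apply/asboolP; exists p'; split => //; apply: le_trans p'p pinf.
Qed.

(* A chain of least size among the near-minimal ones cannot skip a point within
   distance [sg], since deleting a point does not increase the cost. *)
Lemma exists_quasigeodesic x y D : O x -> O y -> enorm (x - y) = D -> sg <= D ->
  D <= theta0 ->
  exists (m : nat) (X : nat -> V),
  [/\ [/\ (0 < m)%N, X 0%N = x & forall k, (m <= k)%N -> X k = y],
      forall k, O (X k),
      forall k, enorm (X k - X k.+1) <= sg,
      forall k, (k.+2 <= m)%N -> sg < enorm (X k - X k.+2) &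
      (forall i j, (i < j <= m)%N -> (j - i)%:R * sg <= theta0 ->
        \sum_(i <= k < j) step_cost (X k) <= (8 * C0 + 2) * ((j - i)%:R * sg) `^ al) /\
      \sum_(0 <= k < m) step_cost (X k) <= (8 * C0 + 2) * D `^ al].
Proof.
move=> Ox Oy xyD sgD Dt; have [al0 al1] := andP al01.
have xyD' : enorm (x - y) <= D by rewrite xyD.
have [p0 cp0 costp0] := chain_of_curve al01 C0_gt0 oO bdO sub sg0 Ox Oy xyD' Dt sgD.
have [p [cp pmin psize]] := near_minimal_chain (ex_intro _ p0 cp0).
have [pp lp Op] := cp.
(* With default value [y] the sequence rests at [y] after the end of the chain, so these bounds need
   no restriction on [k]. *)
have OX k : O (nth y (x :: p) k).
  have [km|mk] := ltnP k (size (x :: p)); last by rewrite nth_default.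
  have := mem_nth y km; rewrite inE => /orP[/eqP->//|]; exact: Op.
have Xm k : (size p <= k)%N -> nth y (x :: p) k = y.
  rewrite leq_eqVlt => /orP[/eqP<-|?]; last by rewrite nth_default.
  by rewrite -(last_take_nth x y (leqnn _)) take_size.
have Xstep k : enorm (nth y (x :: p) k - nth y (x :: p) k.+1) <= sg.
  have [kp|pk] := ltnP k (size p).
    by move/pathP : pp => /(_ y k kp).
  by rewrite !Xm// ?subrr ?enorm0 ?ltW// ltnW.
have Xdist i k : enorm (nth y (x :: p) i - nth y (x :: p) (i + k)) <= k%:R * sg.
  elim: k => [|k IH]; first by rewrite addn0 subrr enorm0 mul0r.
  apply: le_trans (enorm_triangle (nth y (x :: p) (i + k)) _ _) _.
  by rewrite addnS -natr1 mulrDl mul1r lerD.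
exists (size p), (nth y (x :: p)); split => //.
- split => //; rewrite lt0n; apply/eqP => p0'.
  by move: sgD; rewrite -xyD -lp (size0nil p0') /= subrr enorm0 leNgt sg0.
- move=> k kp; rewrite ltNge; apply/negP => short.
  have [||p' [cp' sp' costp']] := @chain_splice x y p [:: nth y (x :: p) k.+2] k k.+2 cp.
  + by rewrite kp leqW.
  + by split; rewrite /= ?short// => z; rewrite inE => /eqP->; exact: (OX k.+2).
  have : (size p <= size p')%N.
    apply: psize => //; rewrite costp' cost_cons cost_nil addr0.
    rewrite big_nat_recr ?leqW// big_nat1/=.
    rewrite opprD addrA [leLHS]addrAC subrK gerDl oppr_le0.
    exact: (step_cost_ge0 O al sg0).
  by rewrite sp' /=; clear -kp; lia.
split; last first.
  rewrite -(cost_take x y (leqnn _)) take_size.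
  apply: le_trans (pmin _ cp0) _; move: costp0.
  have : sg `^ al <= D `^ al by rewrite ge0_ler_powR ?nnegrE// ?(ltW al0)// ?(ltW sg0)// (le_trans (ltW sg0)).
  lra.
move=> i j /andP[ij jm] jit.
(* The part from [i] to [j] is compared with a new chain of cost at most [(8 C0 + 1) h^al]; the
   tolerance [sg^al <= h^al] raises the constant to [8 C0 + 2]. *)
set h := (j - i)%:R * sg.
have sgh : sg <= h by rewrite ler_peMl ?(ltW sg0)// ler1n subn_gt0.
have dij : enorm (nth y (x :: p) i - nth y (x :: p) j) <= h.
  by have := Xdist i (j - i)%N; rewrite subnKC// ltnW.
have [r cr costr] := chain_of_curve al01 C0_gt0 oO bdO sub sg0 (OX i) (OX j) dij jit sgh.
have [|p' [cp' _ costp']] := chain_splice cp _ cr; first by rewrite (ltnW ij).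
have := pmin _ cp'; rewrite costp'.
have : sg `^ al <= h `^ al.
  by rewrite ge0_ler_powR ?nnegrE// ?(ltW al0)// ?(ltW sg0)// (le_trans (ltW sg0)).
move: costr; set S := \sum_(_ <= _ < _) _.
by move: (cost x p) (cost _ r) S (sg `^ al) (h `^ al) => a b c d e; lra.
Qed.

(** The discrete form of [curve_stays_close]: the chain never gets farther than [Q D] from the
    boundary before its end, so each step costs at least [sg (Q D)^(al - 1)], and the total cost
    bounds the number of steps. *)
Lemma quasigeodesic_length (X : nat -> V) m D C Q : 0 < C -> sg <= D -> 5 <= Q ->
  C < (Q - 3) * Q `^ (al - 1) -> dl O (X 0%N) < 2 * D ->
  (forall k, O (X k)) ->
  (forall k, enorm (X k - X k.+1) <= sg) ->
  \sum_(0 <= k < m) step_cost (X k) <= C * D `^ al ->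
  m%:R * sg <= C * Q * D.
Proof.
move=> C_gt0 sgD Q5 Qbig X0 OX Xstep cost_le; have [al0 al1] := andP al01.
have D0 : 0 < D by apply: lt_le_trans sgD.
have Q0 : 0 < Q by lra.
have QD0 : 0 < Q * D by rewrite mulr_gt0.
have P0 := powR_gt0 (al - 1) D0.
have Q1 := powR_gt0 (al - 1) Q0.
have al10 : al - 1 <= 0 by rewrite subr_le0 ltW.
have sgQD : sg <= Q * D by apply: le_trans sgD _; rewrite ler_peMl ?(ltW D0)//; lra.
have Xdist k : dl O (X k) <= dl O (X 0%N) + k%:R * sg.
  elim: k => [|k IH]; first by rewrite mul0r addr0.
  have := dl_lip bdO (X k.+1) (X k); rewrite enormB.
  by have := Xstep k; rewrite -natr1 mulrDl mul1r; lra.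
have cost_lb j : (forall k, (k < j)%N -> dl O (X k) <= Q * D) ->
    j%:R * (sg * (Q * D) `^ (al - 1)) <= \sum_(0 <= k < j) step_cost (X k).
  move=> H; rewrite -{1}[j]subn0; apply: sum_ge_const => k /andP[_ kj].
  rewrite ler_wpM2l ?(ltW sg0)// le_powR_neg ?(tdl_gt0 O sg0)//.
  by rewrite /tdl ge_max H.
have close k : (k < m)%N -> dl O (X k) <= Q * D.
  move=> km; rewrite leNgt; apply/negP => dk.
  have exj : exists j, (j < m)%N && (Q * D < dl O (X j)) by exists k; rewrite km.
  case: (ex_minnP exj) => j /andP[jm dj] jmin.
  have before i : (i < j)%N -> dl O (X i) <= Q * D.
    move=> ij; rewrite leNgt; apply/negP => di.
    by have := jmin i; rewrite di (ltn_trans ij jm) leqNgt ij => /(_ isT).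
  have lb := cost_lb _ before.
  have : \sum_(0 <= k < j) step_cost (X k) <= C * D `^ al.
    apply: le_trans cost_le; rewrite [leRHS](@big_cat_nat _ _ _ j)//= ?(ltnW jm)//.
    by rewrite lerDl sumr_ge0// => i _; exact: (step_cost_ge0 O al sg0).
  move=> /(le_trans lb); rewrite mulrA powRM ?(ltW Q0) ?(ltW D0)//.
  rewrite -(mul_powRB1 al D0) leNgt => /negP; apply.
  apply: (@lt_le_trans _ _ ((Q - 3) * D * (Q `^ (al - 1) * D `^ (al - 1)))).
    by rewrite mulrACA ltr_pM2r ?mulr_gt0.
  rewrite ler_wpM2r ?mulr_ge0 ?(ltW P0) ?(ltW Q1)//.
  have := Xdist j; lra.
have := le_trans (cost_lb _ close) cost_le.
rewrite mulrA powRM ?(ltW Q0) ?(ltW D0)// -(mul_powRB1 al D0) mulrA.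
rewrite [C * _]mulrA ler_pM2r// -[al - 1]opprB powRN ler_pdivrMr ?powR_gt0//.
move=> /le_trans; apply; rewrite [leRHS]mulrAC ler_wpM2l ?mulr_ge0 ?(ltW C_gt0) ?(ltW D0)//.
by rewrite -{2}[Q]powRr1 ?(ltW Q0)// ler_powR; lra.
Qed.

End NearMinimalChain.

(** * Concatenation of curves *)

Section Concatenation.
Variables (R : realType) (n : nat).
Local Notation V := 'rV[R]_n.

Variables (p : nat) (G : nat -> R -> V) (Y : nat -> V).
Hypothesis p0 : (0 < p)%N.
Hypothesis Gcont : forall k, {within `[0, 1], continuous (G k)}.
Hypothesis G0 : forall k, G k 0 = Y k.
Hypothesis G1 : forall k, G k 1 = Y k.+1.

(** Each piece occupies a parameter interval of length [1 / p]; the minimum with [p.-1] puts [t = 1]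
    in the last piece. *)
Definition concat (t : R) : V :=
  let k := minn (Num.truncn (p%:R * t)) p.-1 in G k (p%:R * t - k%:R).

Let p0' : 0 < p%:R :> R. Proof. by rewrite ltr0n. Qed.

Lemma concat_piece k t : (k < p)%N -> k%:R / p%:R <= t <= k.+1%:R / p%:R ->
  concat t = G k (p%:R * t - k%:R).
Proof.
move=> kp /andP[]; rewrite ler_pdivrMr// ler_pdivlMr// ![t * _]mulrC => kt tk.
rewrite /concat; have [ptk|ptk] := eqVneq (p%:R * t) k.+1%:R.
  rewrite ptk natrK; have [kp1|pk1] := ltnP k.+1 p.
    have -> : minn k.+1 p.-1 = k.+1 by apply/minn_idPl; rewrite -ltnS prednK.
    by rewrite subrr G0 -natr1 addrAC subrr add0r G1.
  have -> : minn k.+1 p.-1 = k by rewrite minnC; clear -kp pk1; lia.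
  by [].
have -> : Num.truncn (p%:R * t) = k.
  by apply: truncn_def; rewrite kt/= lt_neqAle ptk tk.
by have -> : minn k p.-1 = k by clear -kp; lia.
Qed.

Lemma concat_knot k : (k <= p)%N -> concat (k%:R / p%:R) = Y k.
Proof.
rewrite leq_eqVlt => /orP[/eqP->|kp].
  rewrite (@concat_piece p.-1) ?prednK//; last first.
    by rewrite lexx andbT ler_pM2r ?invr_gt0// ler_nat leq_pred.
  have pE : p%:R = p.-1%:R + 1 :> R by rewrite natr1 prednK.
  have -> : p%:R * (p%:R / p%:R) - p.-1%:R = 1 :> R.
    by rewrite divff ?gt_eqF// mulr1 {1}pE addrAC subrr add0r.
  by rewrite G1 prednK.
rewrite (@concat_piece k)//; last by rewrite lexx ler_pM2r ?invr_gt0// ler_nat leqnSn.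
by rewrite mulrCA divff ?gt_eqF// mulr1 subrr G0.
Qed.

Lemma concat_continuous : {within `[0, 1], continuous concat}.
Proof.
suff H k : (k <= p)%N -> {within `[0, k%:R / p%:R], continuous concat}.
  by have := H p (leqnn p); rewrite divff ?gt_eqF.
elim: k => [|k IH] kp.
  rewrite mul0r; apply/within_itv_continuousP => x x0 e e0; exists 1 => // t t0 _.
  have -> : x = t by move: x0 t0; lra.
  by rewrite subrr enorm0.
have kk1 : k%:R / p%:R <= k.+1%:R / p%:R :> R by rewrite ler_pM2r ?invr_gt0// ler_nat.
have k0 : 0 <= k%:R / p%:R :> R by rewrite divr_ge0.
have -> : `[0, k.+1%:R / p%:R]%classic =
    `[0, k%:R / p%:R] `|` `[k%:R / p%:R, k.+1%:R / p%:R] :> set R.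
  apply/seteqP; split => t /=; rewrite !in_itv/=.
    by move=> /andP[t0 tk]; have [tl|tl] := leP t (k%:R / p%:R); [left; rewrite t0|right; rewrite ltW].
  by move=> [/andP[-> tk]|/andP[kt ->]]; rewrite ?(le_trans tk)// (le_trans k0).
apply: withinU_continuous; [exact: itv_closed|exact: itv_closed|exact: IH (ltnW kp)|].
apply/within_itv_continuousP => x xk e e0.
have in01 (t : R) : k%:R / p%:R <= t <= k.+1%:R / p%:R -> 0 <= p%:R * t - k%:R <= 1.
  rewrite ler_pdivrMr// ler_pdivlMr// -natr1 ![t * _]mulrC; lra.
have [r r0 Hr] := (within_itv_continuousP (G k) 0 1).1 (@Gcont k) _ (in01 _ xk) _ e0.
exists (r / p%:R); first by rewrite divr_gt0.
move=> t tk; rewrite ltr_pdivlMr// => xt.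
rewrite (concat_piece kp xk) (concat_piece kp tk); apply: Hr; first exact: in01.
have -> : p%:R * x - k%:R - (p%:R * t - k%:R) = (x - t) * p%:R by ring.
by rewrite normrM (ger0_norm (ltW p0')).
Qed.

Lemma concat_in (S : set V) : (forall k t, 0 <= t <= 1 -> S (G k t)) ->
  forall t, 0 <= t <= 1 -> S (concat t).
Proof.
move=> GS t /andP[t0 t1].
have [k kp tk] : exists2 k, (k < p)%N & k%:R / p%:R <= t <= k.+1%:R / p%:R.
  by apply: grid_cell => //; rewrite t0 divff ?gt_eqF.
rewrite (concat_piece kp tk); apply: GS; move: tk.
rewrite ler_pdivrMr// ler_pdivlMr// -natr1 ![t * _]mulrC; lra.
Qed.

Lemma concat_lineint k f : (k < p)%N -> (forall z, 0 <= f z)%E ->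
  (lineint concat (k%:R / p%:R) (k.+1%:R / p%:R) f <= lineint (G k) 0 1 f)%E.
Proof.
move=> kp f0.
have := @lineint_affine_le _ _ concat (G k) f p%:R (- k%:R) (k%:R / p%:R) (k.+1%:R / p%:R) p0' f0.
rewrite !(mulrCA p%:R) divff ?gt_eqF// !mulr1 subrr -natr1 addrAC subrr add0r natr1.
by apply => t /(concat_piece kp).
Qed.

End Concatenation.

(** * Kept edges and the gaps between them *)

Section Arcs.
Variables (R : realType) (n p : nat) (good : pred nat).
Hypothesis p0 : (0 < p)%N.
Local Notation V := 'rV[R]_n.

Definition arcs_from i : seq (R * R) :=
  [seq (k%:R / p%:R, k.+1%:R / p%:R) | k <- iota i (p - i) & good k].

Let p0' : 0 < p%:R :> R. Proof. by rewrite ltr0n. Qed.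

Lemma arcs_fromS i : (i < p)%N -> arcs_from i =
  if good i then (i%:R / p%:R, i.+1%:R / p%:R) :: arcs_from i.+1 else arcs_from i.+1.
Proof. by move=> ip; rewrite /arcs_from subnS; case: (p - i)%N (subn_gt0 i p) => [|l]; rewrite ip// => _ /=; case: ifP. Qed.

Lemma arcs_fromp : arcs_from p = [::].
Proof. by rewrite /arcs_from subnn. Qed.

Lemma knot_lt i : i%:R / p%:R < i.+1%:R / p%:R :> R.
Proof. by rewrite ltr_pM2r ?invr_gt0// ltr_nat. Qed.

Lemma arcs_ok_from : arcs_ok (arcs_from 0).
Proof.
split; last by apply/allP => _ /mapP[k _ ->] /=; exact: knot_lt.
suff H k i (c : R) : (i + k = p)%N -> c <= i%:R / p%:R ->
    path <=%R c (flatten [seq [:: ab.1; ab.2] | ab <- arcs_from i] ++ [:: 1]).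
  by apply: (H p 0%N); rewrite ?add0n// mul0r.
elim: k i c => [|k IH] i c ip ci.
  rewrite addn0 in ip; rewrite ip arcs_fromp /= andbT.
  by move: ci; rewrite ip divff ?gt_eqF.
have ip' : (i < p)%N by clear -ip; lia.
have ip1 : (i.+1 + k = p)%N by rewrite addSnnS.
rewrite arcs_fromS//; case: ifP => _ /=.
  by rewrite ci (ltW (knot_lt i))/=; apply: IH.
by apply: IH => //; apply: le_trans ci (ltW (knot_lt i)).
Qed.

Lemma arcs_int_from (g : R -> V) f : arcs_int g (arcs_from 0) f =
  (\sum_(0 <= k < p | good k) lineint g (k%:R / p%:R) (k.+1%:R / p%:R) f)%E.
Proof.
by rewrite /arcs_int big_map big_filter subn0 /index_iota subn0.
Qed.

Lemma gaps_int_le (g : R -> V) (f : V -> \bar R) : (forall z, 0 <= f z)%E ->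
  (arcs_int g (gaps (arcs_from 0)) f <=
  \sum_(0 <= k < p | ~~ good k) lineint g (k%:R / p%:R) (k.+1%:R / p%:R) f)%E.
Proof.
move=> f0.
(* Here [c] is the end of the last kept edge, so the current gap runs from [c] to the knot [i / p];
   a rejected edge is added to it by subadditivity. *)
suff H k i (c : R) : (i + k = p)%N -> c <= i%:R / p%:R ->
   (arcs_int g (zip (c :: map snd (arcs_from i)) (map fst (arcs_from i) ++ [:: 1%R])) f <=
    lineint g c (i%:R / p%:R) f +
    \sum_(i <= k < p | ~~ good k) lineint g (k%:R / p%:R) (k.+1%:R / p%:R) f)%E.
  have := H p 0%N 0 (add0n p); rewrite mul0r lineint_refl add0e; exact.
elim: k i c => [|k IH] i c ip ci.
  rewrite addn0 in ip; rewrite ip arcs_fromp /= /arcs_int big_seq1/=.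
  by rewrite divff ?gt_eqF// big_geq// adde0.
have ip' : (i < p)%N by clear -ip; lia.
have ip1 : (i.+1 + k = p)%N by rewrite addSnnS.
rewrite arcs_fromS// big_ltn_cond//; case: ifP => gi /=.
  rewrite /arcs_int big_cons /= leeD2l//.
  by have := IH _ _ ip1 (lexx (i.+1%:R / p%:R)); rewrite lineint_refl add0e.
apply: le_trans (IH _ c ip1 (le_trans ci (ltW (knot_lt i)))) _.
by rewrite addeA leeD2r// lineint_subadd// ltW// knot_lt.
Qed.

Lemma lineint_knots_le (g : R -> V) (f : V -> \bar R) : (forall z, 0 <= f z)%E ->
  (lineint g 0 1 f <=
   \sum_(0 <= k < p) lineint g (k%:R / p%:R) (k.+1%:R / p%:R) f)%E.
Proof.
move=> f0.
suff H k : (lineint g 0 (k%:R / p%:R) f <=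
   \sum_(0 <= k < k) lineint g (k%:R / p%:R) (k.+1%:R / p%:R) f)%E.
  by have := H p; rewrite divff ?gt_eqF.
elim: k => [|k IH]; first by rewrite mul0r lineint_refl big_geq.
rewrite big_nat_recr//=; apply: le_trans (leeD2r _ IH).
by rewrite lineint_subadd ?divr_ge0// ltW// knot_lt.
Qed.

End Arcs.

(** * Density on balls *)

Lemma diam_eball (R : realType) (n : nat) (c : 'rV[R]_n) (r : R) :
  (diam (eball c r) <= (2 * r)%:E)%E.
Proof.
apply: ge_ereal_sup => _ [u ur [v vr <-]]; rewrite lee_fin.
have := enorm_triangle c u v; rewrite [enorm (c - v)]enormB.
by move: ur vr; rewrite /eball /=; lra.
Qed.

Lemma half_interval (R : realType) (s q : R) : 0 <= s <= 1 -> 0 < q -> q <= 1 / 2 ->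
  exists s1 s2, [/\ 0 <= s1, s1 <= s2, s2 <= 1, s2 - s1 = q &
    forall u, s1 <= u <= s2 -> `|u - s| <= q].
Proof.
move=> s01 q0 q2; have [sle|sgt] := leP s (1 / 2).
  by exists s, (s + q); split; try lra; move=> u us; rewrite ler_norml; lra.
by exists (s - q), s; split; try lra; move=> u us; rewrite ler_norml; lra.
Qed.

Section BallCondition.
Variables (R : realType) (n : nat).
Local Notation V := 'rV[R]_n.
Variables (sg : R) (p : nat) (Y : nat -> V) (G : nat -> R -> V) (good : pred nat).
Hypotheses (sg0 : 0 < sg) (p0 : (0 < p)%N).
Hypothesis G0 : forall k, G k 0 = Y k.
Hypothesis G1 : forall k, G k 1 = Y k.+1.
Hypothesis Gseg : forall k, good k -> G k = segment (Y k) (Y k.+1).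
Hypothesis good_lt : forall k, good k -> (k.+1 < p)%N.
Hypothesis Ystep : forall k, enorm (Y k - Y k.+1) <= 2 * sg.
Hypothesis Ylong : forall k, (k.+1 < p)%N -> sg < enorm (Y k - Y k.+1).
Local Notation Gam := (concat p G).
Local Notation arcs := (arcs_from R p good 0).

Let p0' : 0 < p%:R :> R. Proof. by rewrite ltr0n. Qed.

Lemma set_ind_ge0 (B : set V) z : (0 <= set_ind (R := R) B z)%E.
Proof. by rewrite /set_ind; case: ifP. Qed.

Lemma knot_interval k (s : R) : 0 <= s <= 1 ->
  k%:R / p%:R <= (k%:R + s) / p%:R <= k.+1%:R / p%:R.
Proof. by rewrite !ler_pM2r ?invr_gt0// -natr1 lerDl lerD2l. Qed.

Lemma concat_good k s : good k -> 0 <= s <= 1 ->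
  Gam ((k%:R + s) / p%:R) = segment (Y k) (Y k.+1) s.
Proof.
move=> gk s01; have kp := ltnW (good_lt gk).
rewrite (concat_piece p0 G0 G1 kp (knot_interval k s01)) Gseg//.
by congr segment; rewrite mulrCA divff ?gt_eqF// mulr1 addrAC subrr add0r.
Qed.

Lemma edge_in_ball k c r s1 s2 : good k -> 0 <= s1 -> s1 <= s2 -> s2 <= 1 ->
  (forall s, s1 <= s <= s2 -> enorm (segment (Y k) (Y k.+1) s - c) < r) ->
  (((s2 - s1) * enorm (Y k - Y k.+1))%:E <=
   lineint Gam (k%:R / p%:R) (k.+1%:R / p%:R) (set_ind (eball c r)))%E.
Proof.
move=> gk s10 s12 s21 inB.
have in1 : 0 <= s1 <= 1 by rewrite s10 (le_trans s12).
have in2 : 0 <= s2 <= 1 by rewrite s21 andbT (le_trans s10).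
have /andP[k1 _] := knot_interval k in1; have /andP[_ k2] := knot_interval k in2.
have s12' : (k%:R + s1) / p%:R <= (k%:R + s2) / p%:R.
  by rewrite ler_pM2r ?invr_gt0// lerD2l.
apply: le_trans (lineint_sub Gam k1 s12' k2 (@set_ind_ge0 _)).
have := @chord_le_lineint _ _ Gam (set_ind (eball c r)) 1 _ _ s12'.
rewrite !concat_good// enorm_segmentB ger0_norm ?subr_ge0// mul1r; apply.
move=> t /andP[t1 t2].
pose s := t * p%:R - k%:R.
have tE : t = (k%:R + s) / p%:R by rewrite /s addrC subrK mulfK// gt_eqF.
move: t1 t2; rewrite tE !ler_pM2r ?invr_gt0// !lerD2l => t1 t2.
rewrite concat_good ?(le_trans s10)//= ?(le_trans t2)// /set_ind.
by case: asboolP => // -[]; apply: inB; rewrite t1.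
Qed.

Lemma arcs_int_ge0 (i j : nat) (f : V -> \bar R) : (forall z, 0 <= f z)%E ->
  (0 <= \sum_(i <= k < j | good k) lineint Gam (k%:R / p%:R) (k.+1%:R / p%:R) f)%E.
Proof.
by move=> f0; apply: sume_ge0 => k _; rewrite lineint_ge0// ltW// knot_lt.
Qed.

Lemma arcs_int_sub (i j : nat) (f : V -> \bar R) : (forall z, 0 <= f z)%E ->
  (i <= j <= p)%N ->
  (\sum_(i <= k < j | good k) lineint Gam (k%:R / p%:R) (k.+1%:R / p%:R) f <=
   arcs_int Gam arcs f)%E.
Proof.
move=> f0 /andP[ij jp]; rewrite arcs_int_from.
rewrite [leRHS](@big_cat_nat _ _ _ i)//=; last exact: leq_trans jp.
rewrite [X in (_ <= _ + X)%E](@big_cat_nat _ _ _ j)//= addeA.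
by rewrite -[leLHS]adde0 leeD ?arcs_int_ge0// leeDr// arcs_int_ge0.
Qed.

(** The edge of the center is longer than [sg], so on one side of the center it has a piece of
    length [min(r, sg) / 2], which lies in the ball. As [r <= 16 N0 sg], this is at least
    [2 r / (64 N0)]. *)
Lemma ball_own_edge k s r (N0 : nat) : good k -> 0 <= s <= 1 -> 0 < r ->
  (0 < N0)%N -> r <= 16 * N0%:R * sg ->
  ((2 * r)%:E <= (64 * N0%:R)%:E *
    arcs_int Gam arcs (set_ind (eball (segment (Y k) (Y k.+1) s) r)))%E.
Proof.
move=> gk s01 r0 N00 rN.
set c := segment _ _ s; set l := enorm (Y k - Y k.+1).
have lsg : sg < l by apply: Ylong; exact: good_lt.
have l0 : 0 < l by apply: lt_trans lsg.
pose m := Num.min r sg / 2.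
have mr : m <= r / 2 by rewrite ler_pM2r ?invr_gt0// ge_min lexx.
have msg : m <= sg / 2 by rewrite ler_pM2r ?invr_gt0// ge_min lexx orbT.
have m0 : 0 < m by rewrite divr_gt0// lt_min r0.
have N1 : 1 <= N0%:R :> R by rewrite ler1n.
have mbig : 2 * r <= 64 * N0%:R * m.
  have rN0 : r <= N0%:R * r by rewrite ler_peMl// ltW.
  by rewrite /m; case: (leP r sg) => _; lra.
have ml : m / l <= 1 / 2.
  by rewrite ler_pdivrMr//; lra.
have ml0 : 0 < m / l by rewrite divr_gt0.
have near u : `|u - s| <= m / l -> enorm (segment (Y k) (Y k.+1) u - c) < r.
  move=> us; rewrite enorm_segmentB -/l; apply: (@le_lt_trans _ _ m).
    by rewrite -ler_pdivlMr.
  by lra.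
have [s1' [s2' [h1 h2 h3 h4 h5]]] := half_interval s01 ml0 ml.
have := edge_in_ball gk h1 h2 h3 (fun u us => near u (h5 u us)).
rewrite h4 -/l divfK ?gt_eqF// => mle.
have := @arcs_int_sub k k.+1 (set_ind (eball c r)) (@set_ind_ge0 _).
rewrite leqnSn/= => /(_ (ltnW (good_lt gk))).
rewrite big_mkcond big_nat1 gk => /(le_trans mle) mint.
apply: (@le_trans _ _ ((64 * N0%:R)%:E * m%:E)%E); first by rewrite -EFinM lee_fin.
by rewrite lee_wpmul2l// lee_fin mulr_ge0.
Qed.

Lemma Ydist i d : enorm (Y i - Y (i + d)) <= d%:R * (2 * sg).
Proof.
elim: d => [|d IH]; first by rewrite addn0 subrr enorm0 mul0r.
apply: le_trans (enorm_triangle (Y (i + d)) _ _) _.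
by rewrite addnS -natr1 mulrDl mul1r lerD.
Qed.

(** Since [r] is at most the distance of the endpoints, one of them is at least [r / 2 >= 8 N sg]
    away from the center. With steps of at most [2 sg] there are at least [4 N - 1] steps on that
    side, hence room for [N] consecutive ones near the center. *)
Lemma run_in_ball k s r (N : nat) : (k < p)%N -> 0 <= s <= 1 -> (0 < N)%N ->
  N%:R * (16 * sg) <= r -> r <= enorm (Y 0%N - Y p) ->
  exists i, (i + N < p)%N /\ forall l, (i <= l < i + N)%N ->
    enorm (Y l - segment (Y k) (Y k.+1) s) <= (N%:R + 1) * (2 * sg).
Proof.
move=> kp s01 N0 Nr rD; set c := segment _ _ s.
have kc : enorm (Y k - c) <= 2 * sg.
  exact: le_trans (enorm_segment_start _ _ s01) (Ystep k).
have N1 : 1 <= N%:R :> R by rewrite ler1n.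
have sg20 : 0 < 2 * sg by rewrite mulr_gt0.
have far : r / 2 <= enorm (Y 0%N - c) \/ r / 2 <= enorm (c - Y p).
  have [?|h] := leP (r / 2) (enorm (Y 0%N - c)); [by left|right].
  have := enorm_triangle c (Y 0%N) (Y p); lra.
have close_gen (q : R) : (q + 1) * (2 * sg) >= r / 2 -> 4 * N%:R - 1 <= q.
  move=> h; have sg2 : 0 < 2 * sg by rewrite mulr_gt0.
  rewrite lerBlDr -(ler_pM2r sg2); lra.
case: far => far.
  have kN : (N + N <= k)%N.
    have := Ydist 0 k; rewrite add0n => Y0k.
    have := enorm_triangle (Y k) (Y 0%N) c => tri.
    have : 4 * N%:R - 1 <= k%:R :> R by apply: close_gen; lra.
    move=> h; rewrite -(ler_nat R) natrD; lra.
  exists (k - N)%N; split; first by clear -kN kp N0; lia.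
  move=> l /andP[l1 l2].
  have lk : (l <= k)%N by clear -l2 kN; lia.
  have := Ydist l (k - l); rewrite subnKC// => Ylk.
  have := enorm_triangle (Y k) (Y l) c => tri.
  have : (k - l)%:R <= N%:R :> R by rewrite ler_nat; clear -l1 kN; lia.
  by rewrite -(ler_pM2r sg20); lra.
have kN : (k + N < p)%N.
  have := Ydist k (p - k); rewrite subnKC ?(ltnW kp)// => Ykp.
  have := enorm_triangle (Y k) c (Y p); rewrite [enorm (c - Y k)]enormB => tri.
  have : 4 * N%:R - 1 <= (p - k)%:R :> R by apply: close_gen; lra.
  move=> h; have : (N.*2 <= p - k)%N.
    by rewrite -(ler_nat R) -muln2 natrM; lra.
  by clear -N0 kp; lia.
exists k; split => // l /andP[kl lk].
have := Ydist k (l - k); rewrite subnKC// enormB => Ykl.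
have := enorm_triangle (Y k) (Y l) c => tri.
have : (l - k)%:R <= N%:R :> R by rewrite ler_nat; clear -kl lk; lia.
by rewrite -(ler_pM2r sg20); lra.
Qed.

(** With [N] the integer part of [r / (16 sg)], a run of [N] edges lies within
    [(N + 2) 2 sg <= 6 N sg < r] of the center. At least [N / 2] of them are kept and longer than
    [sg], while [2 r < 32 (N + 1) sg <= 64 N sg]; hence the factor 128. *)
Lemma ball_run k s r (N0 : nat) : good k -> 0 <= s <= 1 -> (0 < N0)%N ->
  16 * N0%:R * sg < r -> r <= enorm (Y 0%N - Y p) ->
  (forall i N, (N0 <= N)%N -> (i + N < p)%N ->
     N%:R / 2 <= \sum_(i <= l < i + N | good l) (1 : R)) ->
  ((2 * r)%:E <= 128%:E *
    arcs_int Gam arcs (set_ind (eball (segment (Y k) (Y k.+1) s) r)))%E.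
Proof.
move=> gk s01 N00 rN rD many; set c := segment _ _ s.
have sg16 : 0 < 16 * sg by rewrite mulr_gt0.
have rsg0 : 0 <= r / (16 * sg).
  rewrite divr_ge0 ?(ltW sg16)//; apply: le_trans (ltW rN).
  by rewrite !mulr_ge0// ltW.
have := truncn_itv rsg0; set N := Num.truncn _ => /andP[Nr rN1].
have N0N : (N0 <= N)%N.
  rewrite -ltnS -(ltr_nat R); apply: le_lt_trans rN1.
  by rewrite ler_pdivlMr// mulrCA mulrA ltW.
have N1 : 1 <= N%:R :> R by rewrite ler1n (leq_trans N00).
rewrite ler_pdivlMr// in Nr; rewrite ltr_pdivrMr// -natr1 in rN1.
have sgN : sg <= N%:R * sg by rewrite ler_peMl// ltW.
have [i [iNp close]] := run_in_ball (ltnW (good_lt gk)) s01 (leq_trans N00 N0N) Nr rD.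
have iN : (i <= i + N <= p)%N by rewrite leq_addr ltnW.
have edge l : (i <= l < i + N)%N -> good l -> (sg%:E <=
   lineint Gam (l%:R / p%:R) (l.+1%:R / p%:R) (set_ind (eball c r)))%E.
  move=> il gl; have := @edge_in_ball l c r 0 1 gl (lexx 0) ler01 (lexx 1).
  rewrite subr0 mul1r => H.
  apply: (@le_trans _ _ (enorm (Y l - Y l.+1))%:E).
    by rewrite lee_fin ltW// Ylong// good_lt.
  apply: H => u u01; have := enorm_triangle (Y l) (segment (Y l) (Y l.+1) u) c.
  rewrite [enorm (segment _ _ _ - Y l)]enormB => tri.
  have := enorm_segment_start (Y l) (Y l.+1) u01; have := Ystep l.
  have := close l il; rewrite -/c; lra.
apply: (@le_trans _ _ (128%:E * (\sum_(i <= l < i + N | good l) sg)%:E)%E).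
  rewrite -EFinM lee_fin.
  have -> : \sum_(i <= l < i + N | good l) sg = sg * \sum_(i <= l < i + N | good l) 1.
    by rewrite mulr_sumr; apply: eq_bigr => l _; rewrite mulr1.
  have := many i N N0N iNp; set S := \sum_(_ <= _ < _ | _) _ => NS.
  by move: NS; rewrite -(ler_pM2l sg0); lra.
rewrite lee_wpmul2l//; apply: le_trans (arcs_int_sub (@set_ind_ge0 _) iN).
rewrite -sumEFin big_nat_cond [leRHS]big_nat_cond.
by apply: lee_sum => l /andP[il gl]; exact: edge.
Qed.

End BallCondition.

(** * Assembly *)

Section Decimation.
Variables (R : realType) (n : nat).
Local Notation V := 'rV[R]_n.
Variables (O : set V) (al C0 theta0 sg : R).
Hypotheses (al01 : 0 < al < 1) (C0_gt0 : 0 < C0) (oO : open O) (bdO : bd O !=set0).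
Hypothesis sub : subhyperbolic al O C0 theta0.
Hypothesis sg0 : 0 < sg.

(** The upper limit lies just past the last even index used. It stays within a chain of [m] steps
    for [j <= uphalf m], whereas [j.*2] exceeds [m] when [m] is odd and [j = uphalf m]. *)
Lemma sum_double_le (F : nat -> R) i j : (forall k, 0 <= F k) -> (i < j)%N ->
  \sum_(i <= k < j) F k.*2 <= \sum_(i.*2 <= k < j.*2.-1) F k.
Proof.
move=> F0 ij; rewrite -(subnKC ij); elim: (j - i.+1)%N => [|d IH].
  by rewrite addn0 doubleS /= !big_nat1.
have [a ia aE] : exists2 a, (i.*2 <= a)%N & (i.+1 + d).*2 = a.+1.
  by exists (i.+1 + d).*2.-1; clear; lia.
have aE' : (i.+1 + d.+1).*2 = a.+3 by rewrite addnS doubleS aE.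
rewrite aE in IH; rewrite aE' addnS big_nat_recr/=; last by rewrite leqW// leq_addr.
rewrite aE (@big_nat_recr _ _ _ a.+1)/= ?(leq_trans ia)//.
rewrite (@big_nat_recr _ _ _ a)//= lerD2r.
by apply: le_trans IH _; rewrite lerDl.
Qed.

Lemma normalized_step_cost z :
  (tdl O sg z / sg) `^ (al - 1) = sg `^ (- al) * (sg * tdl O sg z `^ (al - 1)).
Proof.
rewrite powRM ?(ltW (tdl_gt0 O sg0 z)) ?invr_ge0 ?(ltW sg0)// mulrA mulrC; congr (_ * _).
have := mul_powRB1 (1 - al) sg0; rewrite addrAC subrr add0r mulrC => ->.
rewrite -powR_inv1 ?(ltW sg0)// -powRrM.
by congr (_ `^ _); ring.
Qed.

(* Keeping every other point makes all steps but the last longer than [sg], which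
   the density condition on balls requires at small radii. *)
Lemma exists_decimated_quasigeodesic x y D Q : O x -> O y -> enorm (x - y) = D ->
  sg <= D -> 5 <= Q -> 8 * C0 + 2 < (Q - 3) * Q `^ (al - 1) -> dl O x < 2 * D ->
  (8 * C0 + 2) * Q * D <= theta0 ->
  exists (p : nat) (Y : nat -> V),
  [/\ [/\ (0 < p)%N, Y 0%N = x & Y p = y],
      forall k, O (Y k),
      forall k, enorm (Y k - Y k.+1) <= 2 * sg,
      forall k, (k.+1 < p)%N -> sg < enorm (Y k - Y k.+1) &
      p%:R * sg <= (8 * C0 + 2) * Q * D /\
      forall i j, (i < j <= p)%N ->
        \sum_(i <= k < j) (tdl O sg (Y k) / sg) `^ (al - 1) <=
        2 * (8 * C0 + 2) * (j - i)%:R `^ al].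
Proof.
move=> Ox Oy xyD sgD Q5 Qbig dx Dth; have [al0 al1] := andP al01.
have C20 : 0 < 8 * C0 + 2 by have := C0_gt0; lra.
have D0 : 0 < D by apply: lt_le_trans sgD.
have Dt : D <= theta0.
  apply: le_trans Dth; rewrite ler_peMl ?(ltW D0)//.
  by have := C0_gt0; nra.
have [m [X [[m0 X0 Xm] OX Xstep Xlong [Xcost Xtot]]]] :=
  exists_quasigeodesic al01 C0_gt0 oO bdO sub sg0 Ox Oy xyD sgD Dt.
have dX0 : dl O (X 0%N) < 2 * D by rewrite X0.
have mlen := quasigeodesic_length al01 bdO sg0 C20 sgD Q5 Qbig dX0 OX Xstep Xtot.
exists (uphalf m), (fun k => X k.*2); split => //.
- split; rewrite ?double0//; first by clear -m0; lia.
  by apply: Xm; clear; lia.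
- move=> k; rewrite doubleS; apply: le_trans (enorm_triangle (X k.*2.+1) _ _) _.
  by have := Xstep k.*2; have := Xstep k.*2.+1; lra.
- by move=> k kp; rewrite doubleS; apply: Xlong; clear -kp; lia.
split.
  apply: le_trans mlen; rewrite ler_wpM2r ?(ltW sg0)// ler_nat; clear -m0; lia.
move=> i j /andP[ij jp].
under eq_bigr do rewrite normalized_step_cost.
rewrite -mulr_sumr.
have jm : (j.*2.-1 <= m)%N by clear -jp m0; lia.
have ij2 : (i.*2 < j.*2.-1)%N by clear -ij; lia.
(* The smallness of [D] enters here: the whole chain has total step length at most [theta0], so the
   cost estimate applies to all its parts. *)
have len : (j.*2.-1 - i.*2)%:R * sg <= theta0.
  apply: le_trans Dth; apply: le_trans mlen; rewrite ler_wpM2r ?(ltW sg0)// ler_nat.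
  by clear -jm; lia.
have S1 := Xcost _ _ (introT andP (conj ij2 jm)) len.
have S2 := sum_double_le (fun k => step_cost_ge0 O al sg0 (X k)) ij.
apply: (@le_trans _ _ (sg `^ (- al) * ((8 * C0 + 2) * (2 * (j - i)%:R `^ al * sg `^ al)))).
  rewrite ler_wpM2l ?powR_ge0//; apply: le_trans S2 (le_trans S1 _).
  rewrite ler_wpM2l ?(ltW C20)//.
  have ji0 : 0 <= (j.*2.-1 - i.*2)%:R :> R by [].
  rewrite powRM ?(ltW sg0)// ler_wpM2r ?powR_ge0//.
  apply: (@le_trans _ _ ((2 * (j - i)%:R) `^ al)).
    rewrite ge0_ler_powR ?nnegrE ?mulr_ge0 ?(ltW al0)// -natrM ler_nat; clear; lia.
  rewrite powRM// ler_wpM2r ?powR_ge0// -[leRHS]powRr1// ler_powR; lra.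
rewrite powRN le_eqVlt; apply/orP; left; apply/eqP; field.
by rewrite gt_eqF ?powR_gt0.
Qed.

Lemma tdl_lip u v : tdl O sg u <= tdl O sg v + enorm (u - v).
Proof.
rewrite {1}/tdl ge_max; apply/andP; split.
  by apply: le_trans (dl_lip bdO u v) _; rewrite lerD2r /tdl le_max lexx.
by rewrite -[leLHS]addr0 lerD ?enorm_ge0// /tdl le_max lexx orbT.
Qed.

(** An edge of length at most [2 sg] starting at distance over [4 sg] keeps half that distance. The
    weight grows by at most [2^(1 - tau) <= 2], and the length gives the other factor 2. *)
Lemma good_edge_wt_le u v tau : O u -> enorm (u - v) <= 2 * sg ->
  4 * sg < tdl O sg u -> 0 < tau < 1 ->
  (lineint (segment u v) 0 1 (wt O tau) <= (4 * (sg * tdl O sg u `^ (tau - 1)))%:E)%E.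
Proof.
move=> Ou uv u4 /andP[tau0 tau1].
have du : dl O u = tdl O sg u.
  by move: u4; rewrite /tdl; case: (leP (dl O u) sg) => // _; have := sg0; lra.
have P0 := powR_ge0 (tdl O sg u) (tau - 1).
apply: (@le_trans _ _ ((2 * tdl O sg u `^ (tau - 1)) * enorm (u - v))%:E); last first.
  rewrite lee_fin; apply: (@le_trans _ _ (2 * tdl O sg u `^ (tau - 1) * (2 * sg))).
    by rewrite ler_wpM2l// mulr_ge0.
  by lra.
apply: segment_lineint_le; [by rewrite mulr_ge0|exact: wt_ge0|move=> t t01].
rewrite wtE// lee_fin.
have dseg : tdl O sg u / 2 <= dl O (segment u v t).
  have := dl_lip bdO u (segment u v t); have := enorm_segment_start u v t01.
  by rewrite du; lra.
have t20 : 0 < tdl O sg u / 2 by rewrite divr_gt0// tdl_gt0.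
apply: le_trans (le_powR_neg t20 dseg _) _; first by lra.
rewrite powRM ?(ltW (tdl_gt0 O sg0 u))// mulrC ler_wpM2r//.
rewrite -powR_inv1// -powRrM mulN1r opprB -[leRHS]powRr1// ler_powR; lra.
Qed.

Lemma good_edge_in u v t : O u -> enorm (u - v) <= 2 * sg ->
  4 * sg < tdl O sg u -> 0 <= t <= 1 -> O (segment u v t).
Proof.
move=> Ou uv u4 t01; apply: (dl_ball bdO Ou).
have du : dl O u = tdl O sg u.
  by move: u4; rewrite /tdl; case: (leP (dl O u) sg) => // _; have := sg0; lra.
by have := enorm_segment_start u v t01; have := sg0; rewrite du; lra.
Qed.

End Decimation.

(** An index with [e k <= 4] contributes at least [4^(al - 1) >= 1/4] to the sum. This counts the
    edges too close to the boundary to be kept. *)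
Lemma count_small_le (R : realType) (e : nat -> R) (al S : R) i j : 0 < al < 1 ->
  (forall k, 1 <= e k) -> \sum_(i <= k < j) e k `^ (al - 1) <= S ->
  \sum_(i <= k < j | e k <= 4) (1 : R) <= 4 * S.
Proof.
move=> /andP[al0 al1] e1 eS; apply: (@le_trans _ _ (4 * \sum_(i <= k < j) e k `^ (al - 1))).
  rewrite mulr_sumr big_mkcond; apply: ler_sum => k _.
  case: ifP => [e4|_]; last by rewrite mulr_ge0 ?powR_ge0.
  have e0 : 0 < e k by apply: lt_le_trans (e1 k).
  apply: (@le_trans _ _ (4 * 4^-1)); first by lra.
  rewrite ler_wpM2l//; apply: (@le_trans _ _ (4 `^ (al - 1))); last first.
    by rewrite le_powR_neg//; lra.
  by rewrite -powR_inv1// ler_powR; lra.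
by rewrite ler_wpM2l.
Qed.

Lemma sum_nat_const1 (R : realType) i j : \sum_(i <= k < j) (1 : R) = (j - i)%:R.
Proof. by rewrite sumr_const_nat. Qed.

Definition good_curve (R : realType) (n : nat) (O : set 'rV[R]_n)
    (alpha alpha_s C eps : R) (x y : 'rV[R]_n) : Prop :=
  exists (Gamma : R -> 'rV[R]_n) (s : seq (R * R)),
    rect_curve O x y Gamma /\ arcs_ok s /\
    (forall tau, alpha_s <= tau <= alpha ->
       (arcs_int Gamma s (wt O tau) <= (C * enorm (x - y) `^ tau)%:E)%E) /\
    (forall (c : 'rV[R]_n) (r : R),
       (exists2 ab, ab \in s & exists2 t, ab.1 <= t <= ab.2 & c = Gamma t) ->
       0 < r -> r <= enorm (x - y) ->
       (diam (eball c r) <= C%:E * arcs_int Gamma s (set_ind (eball c r)))%E) /\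
    (curve_length Gamma 0 1 <= (C * enorm (x - y))%:E)%E /\
    (arcs_int Gamma (gaps s) (fun _ => 1%E) < eps%:E)%E /\
    (arcs_int Gamma (gaps s) (wt O alpha) <= (C * enorm (x - y) `^ alpha)%:E)%E.

(** * Pairs joined by a segment *)

Section EasyCases.
Variables (R : realType) (n : nat) (O : set 'rV[R]_n) (al als C eps : R).
Hypotheses (als0 : 0 < als) (al01 : 0 < al < 1) (C4 : 4 <= C) (eps0 : 0 < eps).

Lemma wt_fin_num tau z : wt O tau z \is a fin_num.
Proof. by rewrite /wt; case: dist_bd => [r||]//; case: ifP. Qed.

Lemma good_curve_refl x : O x -> good_curve O al als C eps x x.
Proof.
move=> Ox; have [al0 al1] := andP al01.
have seg t : segment x x t = x by rewrite /segment subrr scaler0 addr0.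
have int0 f : (forall z, 0 <= f z)%E -> (f x \is a fin_num)%E ->
    (arcs_int (segment x x) (gaps [::]) f <= 0)%E.
  move=> f0 fx; rewrite /gaps/= /arcs_int big_seq1/=.
  apply: (@le_trans _ _ (fine (f x) * enorm (x - x))%:E); last first.
    by rewrite subrr enorm0 mulr0.
  apply: segment_lineint_le => // [|t _]; first exact: fine_ge0.
  by rewrite seg fineK.
exists (segment x x), [::]; split; first by apply: segment_rect_curve => t _; rewrite seg.
split; first by split; rewrite //= ler01.
rewrite subrr enorm0; split.
  by move=> tau /andP[t1 t2]; rewrite /arcs_int big_nil lee_fin mulr_ge0 ?powR_ge0//; have := C4; lra.
split; first by move=> c r [ab]; rewrite in_nil.
split.
  by rewrite mulr0; apply: le_trans (segment_length x x) _; rewrite subrr enorm0.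
split; first by apply: le_lt_trans (int0 _ _ _) _ => //; rewrite lte_fin.
apply: le_trans (int0 _ _ _) _; [exact: wt_ge0|exact: wt_fin_num|].
by rewrite lee_fin mulr_ge0 ?powR_ge0//; have := C4; lra.
Qed.

(** The whole segment is one arc and both gaps are degenerate. A ball of radius [r <= D] about one
    of its points contains a piece of length [r / 2], whence [4 <= C]. *)
Lemma good_curve_segment x y : 0 < enorm (x - y) ->
  (forall t, 0 <= t <= 1 -> O (segment x y t)) ->
  (forall tau t, tau < 1 -> 0 <= t <= 1 ->
     (wt O tau (segment x y t) <= (enorm (x - y) `^ (tau - 1))%:E)%E) ->
  good_curve O al als C eps x y.
Proof.
move=> D0 sO swt; have [al0 al1] := andP al01.
set D := enorm (x - y) in D0 swt *.
have C1 : 1 <= C by have := C4; lra.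
exists (segment x y), [:: (0, 1)]; split; first exact: segment_rect_curve.
split; first by split; rewrite /= ?lexx ?ler01 ?ltr01.
split.
  move=> tau /andP[t1 t2]; rewrite /arcs_int big_seq1/=.
  have tau1 : tau < 1 by lra.
  apply: le_trans (segment_lineint_le (powR_ge0 _ _) (@wt_ge0 _ _ O tau) (fun t => swt tau t tau1)) _.
  by rewrite lee_fin mulrC mul_powRB1// ler_peMl ?powR_ge0.
split.
  move=> c r [_ /[!inE]/eqP->/= [s s01 ->]] r0; rewrite -/D => rD.
  have q0 : 0 < r / 2 / D by rewrite !divr_gt0.
  have q2 : r / 2 / D <= 1 / 2 by rewrite ler_pdivrMr//; lra.
  have [s1 [s2 [h1 h2 h3 h4 h5]]] := half_interval s01 q0 q2.
  rewrite /arcs_int big_seq1/=; apply: le_trans (diam_eball _ _) _.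
  have ind0 := @set_ind_ge0 R n (eball (segment x y s) r).
  have : ((r / 2)%:E <= lineint (segment x y) 0 1 (set_ind (eball (segment x y s) r)))%E.
    apply: le_trans (lineint_sub (segment x y) h1 h2 h3 ind0).
    have := @chord_le_lineint _ _ (segment x y) (set_ind (eball (segment x y s) r)) 1 _ _ h2.
    rewrite enorm_segmentB ger0_norm ?subr_ge0// h4 -/D divfK ?gt_eqF// mul1r; apply.
    move=> u /h5 us; rewrite /set_ind; case: asboolP => // -[].
    rewrite /eball/= enorm_segmentB -/D; apply: (@le_lt_trans _ _ (r / 2)); last by lra.
    by rewrite -ler_pdivlMr.
  move=> rle; apply: (@le_trans _ _ (C%:E * (r / 2)%:E)%E).
    by rewrite -EFinM lee_fin; have := C4; nra.
  by rewrite lee_wpmul2l// lee_fin; lra.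
split.
  by apply: le_trans (segment_length x y) _; rewrite lee_fin ler_peMl// ltW.
rewrite /gaps/= /arcs_int !big_cons !big_nil /= !lineint_refl !adde0.
by split; rewrite ?lte_fin// lee_fin mulr_ge0 ?powR_ge0//; have := C4; lra.
Qed.

End EasyCases.

(** * Pairs close to the boundary *)

Section MainCase.
Variables (R : realType) (n : nat) (O : set 'rV[R]_n) (al C0 theta0 : R).
Hypotheses (al01 : 0 < al < 1) (C0_gt0 : 0 < C0) (theta0_gt0 : 0 < theta0).
Hypotheses (oO : open O) (bdO : bd O !=set0).
Hypothesis sub : subhyperbolic al O C0 theta0.
Variables (Q als B : R) (N0 : nat).
Hypotheses (Q5 : 5 <= Q) (Qbig : 8 * C0 + 2 < (Q - 3) * Q `^ (al - 1)).
Local Notation K := ((8 * C0 + 2) * Q).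
Local Notation A := (2 * (8 * C0 + 2)).
Local Notation C4 := (1 + 2 * C0 * Q).
Hypotheses (als_gt0 : 0 < als) (B_gt0 : 0 < B).
Hypothesis improve : forall (p : nat) (e : nat -> R), (0 < p)%N ->
  (forall k, 1 <= e k) ->
  (forall k l, (k <= l)%N -> `|e k - e l| <= 2 * (l - k)%:R) ->
  (forall i j, (i < j <= p)%N ->
     \sum_(i <= k < j) e k `^ (al - 1) <= A * (j - i)%:R `^ al) ->
  forall tau, als <= tau <= al ->
  \sum_(0 <= k < p) e k `^ (tau - 1) <= B * p%:R `^ tau.
Hypothesis N0_gt0 : (0 < N0)%N.
Hypothesis N0_big : forall N, (N0 <= N)%N -> 4 * A * N%:R `^ al <= N%:R / 2.

Local Lemma A_gt0 : 0 < A. Proof. by have := C0_gt0; lra. Qed.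
Local Lemma Q_gt0 : 0 < Q. Proof. by have := Q5; lra. Qed.
Local Lemma C4_ge1 : 1 <= C4. Proof. by rewrite lerDl !mulr_ge0 ?(ltW C0_gt0) ?(ltW Q_gt0). Qed.
Local Lemma K_ge1 : 1 <= K. Proof. by have := C0_gt0; have := Q5; nra. Qed.

Section Decimated.
Variables (sg D : R) (p : nat) (Y : nat -> 'rV[R]_n).
Hypotheses (sg0 : 0 < sg) (sg2 : 2 * sg <= theta0) (D0 : 0 < D) (p0 : (0 < p)%N).
Hypothesis YO : forall k, O (Y k).
Hypothesis Ystep : forall k, enorm (Y k - Y k.+1) <= 2 * sg.
Hypothesis pK : p%:R * sg <= K * D.
Local Notation e := (fun k => tdl O sg (Y k) / sg).
Hypothesis e_sum : forall i j, (i < j <= p)%N ->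
  \sum_(i <= k < j) e k `^ (al - 1) <= A * (j - i)%:R `^ al.

(** The last edge is rejected because decimation does not make it longer than [sg]. *)
Definition good_edge k := (k.+1 < p)%N && (4 < tdl O sg (Y k) / sg).

Local Lemma e_ge1 k : 1 <= e k.
Proof. by rewrite ler_pdivlMr// mul1r /tdl le_max lexx orbT. Qed.

Local Lemma e_lip k l : (k <= l)%N -> `|e k - e l| <= 2 * (l - k)%:R.
Proof.
move=> kl; rewrite -mulrBl normrM normfV (gtr0_norm sg0) ler_pdivrMr//.
have := Ydist Ystep k (l - k); rewrite subnKC// => d.
have := tdl_lip sg bdO (Y k) (Y l).
have := tdl_lip sg bdO (Y l) (Y k); rewrite [enorm (Y l - _)]enormB.
by rewrite ler_norml; lra.
Qed.

(** Away from the last edge, at most [4 A N^al] of [N] consecutive edges are rejected; as [al < 1]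
    this is below [N / 2] once [N >= N0]. *)
Lemma many_good i N : (N0 <= N)%N -> (i + N < p)%N ->
  N%:R / 2 <= \sum_(i <= l < i + N | good_edge l) (1 : R).
Proof.
move=> N0N iNp; have N1 : (0 < N)%N by apply: leq_trans N0N.
have iN : (i < i + N <= p)%N by rewrite -[X in (X < _)%N]addn0 ltn_add2l N1 ltnW.
have := sum_nat_const1 R i (i + N); rewrite addKn (bigID good_edge)/=.
have := count_small_le al01 e_ge1 (e_sum iN); rewrite addKn.
have := N0_big N0N.
have -> : \sum_(i <= l < i + N | ~~ good_edge l) (1 : R) =
          \sum_(i <= l < i + N | tdl O sg (Y l) / sg <= 4) 1.
  apply: congr_big_nat => // l /andP[_ lN]; rewrite /good_edge.
  by rewrite (leq_ltn_trans lN iNp)/= -leNgt.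
lra.
Qed.

Lemma few_bad : \sum_(0 <= l < p | ~~ good_edge l) (1 : R) <= (1 + 4 * A) * p%:R `^ al.
Proof.
have [al0 al1] := andP al01.
have := count_small_le al01 e_ge1 (e_sum (introT andP (conj p0 (leqnn p)))).
rewrite subn0 => small.
have pal : 1 <= p%:R `^ al.
  by rewrite -{1}(powRr0 p%:R) ler_powR ?ler1n// ltW.
apply: (@le_trans _ _ (1 + \sum_(0 <= l < p | tdl O sg (Y l) / sg <= 4) 1)); last first.
  by rewrite mulrDl mul1r -mulrA lerD// mulrA.
rewrite -(prednK p0) big_mkcond [X in _ <= 1 + X]big_mkcond !big_nat_recr//=.
rewrite addrC lerD//; first by case: ifP.
apply: (@le_trans _ _ (\sum_(0 <= i < p.-1) (if tdl O sg (Y i) / sg <= 4 then 1 else 0))).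
  rewrite le_eqVlt; apply/orP; left; apply/eqP; apply: eq_big_nat => l /andP[_ lp].
  by rewrite /good_edge -ltn_predRL lp/= -leNgt.
by rewrite lerDl; case: ifP.
Qed.

Lemma exists_pieces : exists G : nat -> R -> 'rV[R]_n, forall k,
  [/\ rect_curve O (Y k) (Y k.+1) (G k),
      good_edge k -> G k = segment (Y k) (Y k.+1),
      (curve_length (G k) 0 1 <= (C4 * (2 * sg))%:E)%E &
      ~~ good_edge k -> (lineint (G k) 0 1 (wt O al) <= (C4 * (2 * sg) `^ al)%:E)%E].
Proof.
suff H k : exists g, [/\ rect_curve O (Y k) (Y k.+1) g,
      good_edge k -> g = segment (Y k) (Y k.+1),
      (curve_length g 0 1 <= (C4 * (2 * sg))%:E)%E &
      ~~ good_edge k -> (lineint g 0 1 (wt O al) <= (C4 * (2 * sg) `^ al)%:E)%E].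
  by have [G GP] := choice H; exists G.
case: (boolP (good_edge k)) => [gk|_]; last first.
  have sg20 : 0 < 2 * sg by rewrite mulr_gt0.
  have Qbig0 : 2 * C0 < (Q - 3) * Q `^ (al - 1).
    by apply: le_lt_trans Qbig; have := C0_gt0; lra.
  have [g [g1 g2 g3]] := exists_short_curve al01 C0_gt0 oO bdO sub Q5 Qbig0 (YO k)
    (YO k.+1) (Ystep k) sg2 sg20.
  by exists g; split.
exists (segment (Y k) (Y k.+1)); split => //.
  apply: segment_rect_curve => t t01.
  move: gk => /andP[_]; rewrite ltr_pdivlMr// => tk.
  exact: (good_edge_in bdO sg0 (YO k) (Ystep k) tk t01).
apply: le_trans (segment_length _ _) _; rewrite lee_fin (le_trans (Ystep k))//.
by rewrite ler_peMl ?C4_ge1// mulr_ge0// ltW.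
Qed.

Local Lemma powK (tau : R) : 0 <= tau <= 1 -> (p%:R * sg) `^ tau <= K * D `^ tau.
Proof.
move=> /andP[tau0 tau1].
apply: (@le_trans _ _ ((K * D) `^ tau)).
  have psg0 : 0 <= p%:R * sg by rewrite mulr_ge0// ltW.
  by rewrite ge0_ler_powR ?nnegrE// (le_trans psg0 pK).
rewrite powRM ?(ltW D0)//; last exact: le_trans ler01 K_ge1.
rewrite ler_wpM2r ?powR_ge0// -[leRHS]powRr1; last exact: le_trans ler01 K_ge1.
by rewrite ler_powR ?K_ge1.
Qed.

Lemma decimated_good_curve eps C : 0 < eps -> enorm (Y 0%N - Y p) = D ->
  (forall k, (k.+1 < p)%N -> sg < enorm (Y k - Y k.+1)) ->
  2 * C4 * (1 + 4 * A) * K * D `^ al * sg `^ (1 - al) < eps ->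
  4 * B * K <= C -> 128 <= C -> 64 * N0%:R <= C -> 2 * C4 * K <= C ->
  2 * C4 * (1 + 4 * A) * K <= C ->
  good_curve O al als C eps (Y 0%N) (Y p).
Proof.
move=> eps0 Y0p Ylong sgeps hB h128 hN hlen hgap; have [al0 al1] := andP al01.
have E0 : 0 <= 1 + 4 * A by have := A_gt0; lra.
have al01' : 0 <= al <= 1 by rewrite !ltW.
have [G GP] := exists_pieces.
have Gcont k : {within `[0, 1], continuous (G k)} by case: (GP k) => -[].
have G0 k : G k 0 = Y k by case: (GP k) => -[_ []].
have G1 k : G k 1 = Y k.+1 by case: (GP k) => -[_ [_ []]].
have GO k t : 0 <= t <= 1 -> O (G k t) by case: (GP k) => -[_ [_ [_ [H _]]]] _ _ _; exact: H.
have Gseg k : good_edge k -> G k = segment (Y k) (Y k.+1) by case: (GP k).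
have good_lt k : good_edge k -> (k.+1 < p)%N by case/andP.
have C4_ge0 : 0 <= C4 by exact: le_trans ler01 C4_ge1.
have one_ge0 (z : 'rV[R]_n) : (0 <= 1 :> \bar R)%E by [].
have piece := concat_lineint p0 G0 G1.
have len : (curve_length (concat p G) 0 1 <= (2 * C4 * K * D)%:E)%E.
  apply: le_trans (lineint_knots_le p0 _ one_ge0) _.
  apply: (@le_trans _ _ (\sum_(0 <= k < p) (C4 * (2 * sg))%:E)%E).
    rewrite big_nat [leRHS]big_nat; apply: lee_sum => k /andP[_ kp].
    by apply: le_trans (piece _ _ kp one_ge0) _; case: (GP k).
  rewrite sumEFin lee_fin sumr_const_nat subn0 -[leLHS]mulr_natr.
  rewrite (_ : _ * p%:R = 2 * C4 * (p%:R * sg)); last by ring.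
  by rewrite -[leRHS]mulrA ler_wpM2l// mulr_ge0.
(* Used twice: with [f = 1] for the length of the gaps and with the weight for their cost. *)
have gaps_le f (c : R) : (forall z, 0 <= f z)%E -> 0 <= c ->
    (forall k, ~~ good_edge k -> (lineint (G k) 0 1 f <= c%:E)%E) ->
    (arcs_int (concat p G) (gaps (arcs_from R p good_edge 0)) f <=
      (c * ((1 + 4 * A) * p%:R `^ al))%:E)%E.
  move=> f0 c0 fc; apply: le_trans (gaps_int_le _ p0 _ f0) _.
  apply: (@le_trans _ _ (\sum_(0 <= k < p | ~~ good_edge k) c%:E)%E).
    rewrite big_nat_cond [leRHS]big_nat_cond; apply: lee_sum => k /andP[/andP[_ kp] bk].
    exact: le_trans (piece _ _ kp f0) (fc k bk).
  rewrite sumEFin lee_fin.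
  have -> : \sum_(0 <= k < p | ~~ good_edge k) c = c * \sum_(0 <= k < p | ~~ good_edge k) 1.
    by rewrite mulr_sumr; apply: eq_bigr => k _; rewrite mulr1.
  by rewrite ler_wpM2l// few_bad.
have arcs0 f : (forall z, 0 <= f z)%E ->
    (0 <= arcs_int (concat p G) (arcs_from R p good_edge 0) f)%E.
  by move=> f0; rewrite arcs_int_from; exact: arcs_int_ge0.
exists (concat p G), (arcs_from R p good_edge 0); rewrite Y0p; split; [|split; [|split; [|split; [|split; [|split]]]]].
- split; first exact: concat_continuous.
  split; first by have := concat_knot p0 G0 G1 (leq0n p); rewrite mul0r.
  split.
    have := concat_knot p0 G0 G1 (leqnn p).
    by rewrite divff// pnatr_eq0 -lt0n.
  split; last exact: le_lt_trans len (ltry _).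
  exact: (concat_in p0 G0 G1 GO).
- exact: arcs_ok_from.
- move=> tau tau_int; have [t1 t2] := andP tau_int.
  have tau01 : 0 < tau < 1 by rewrite (lt_le_trans als_gt0 t1) (le_lt_trans t2 al1).
  rewrite arcs_int_from.
  apply: (@le_trans _ _ (\sum_(0 <= k < p) (4 * (sg * tdl O sg (Y k) `^ (tau - 1)))%:E)%E).
    rewrite big_mkcond big_nat [leRHS]big_nat; apply: lee_sum => k /andP[_ kp].
    case: ifP => gk; last by rewrite lee_fin mulr_ge0 ?(step_cost_ge0 O tau sg0).
    apply: le_trans (piece _ _ kp (@wt_ge0 _ _ O tau)) _; rewrite Gseg//.
    move: gk => /andP[_]; rewrite ltr_pdivlMr// => tk.
    exact: (good_edge_wt_le bdO sg0 (YO k) (Ystep k) tk tau01).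
  rewrite sumEFin lee_fin -mulr_sumr.
  (* This undoes the normalization by [sg]: the improved bound [B p^tau] becomes [B (p sg)^tau], and
     [p sg <= K D]. *)
  have stepE k : sg * tdl O sg (Y k) `^ (tau - 1) = sg `^ tau * e k `^ (tau - 1).
    rewrite (normalized_step_cost O tau sg0) mulrA -powRD_gt0// subrr powRr0 mul1r//.
  under eq_bigr do rewrite stepE.
  rewrite -mulr_sumr.
  apply: (@le_trans _ _ (4 * (sg `^ tau * (B * p%:R `^ tau)))).
    rewrite ler_wpM2l// ler_wpM2l ?powR_ge0//.
    exact: (improve p0 e_ge1 e_lip e_sum tau_int).
  rewrite (_ : _ * _ = 4 * B * (p%:R `^ tau * sg `^ tau)); last by ring.
  rewrite -powRM ?(ltW sg0)//.
  apply: (@le_trans _ _ (4 * B * (K * D `^ tau))).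
    rewrite ler_wpM2l ?mulr_ge0 ?(ltW B_gt0)// powK//.
    by case/andP: tau01 => /ltW-> /ltW->.
  by rewrite mulrA ler_wpM2r ?powR_ge0.
- move=> c r [ab /mapP[k]]; rewrite mem_filter => /andP[gk _] -> [t /= tk ->] r0 rD.
  have pR : 0 < p%:R :> R by rewrite ltr0n.
  pose s := t * p%:R - k%:R.
  have tE : t = (k%:R + s) / p%:R by rewrite /s addrC subrK mulfK// gt_eqF.
  have s01 : 0 <= s <= 1.
    by move: tk; rewrite tE !ler_pM2r ?invr_gt0// -natr1 lerDl lerD2l.
  rewrite tE (concat_good p0 G0 G1 Gseg good_lt gk s01).
  apply: le_trans (diam_eball _ _) _.
  set ind := set_ind _.
  have ind0 : (0 <= arcs_int (concat p G) (arcs_from R p good_edge 0) ind)%E.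
    by apply: arcs0; exact: set_ind_ge0.
  have [rN|rN] := leP r (16 * N0%:R * sg).
    apply: le_trans (ball_own_edge sg0 p0 G0 G1 Gseg good_lt Ylong gk s01 r0 N0_gt0 rN) _.
    by rewrite lee_wpmul2r.
  have rD' : r <= enorm (Y 0%N - Y p) by rewrite Y0p.
  apply: le_trans (ball_run sg0 p0 G0 G1 Gseg good_lt Ystep Ylong gk s01 N0_gt0 rN rD' many_good) _.
  by rewrite lee_wpmul2r.
- by apply: le_trans len _; rewrite lee_fin ler_wpM2r ?(ltW D0).
- have c0 : 0 <= C4 * (2 * sg) by rewrite !mulr_ge0// ltW.
  apply: le_lt_trans (gaps_le _ _ one_ge0 c0 _) _; first by move=> k _; case: (GP k).
  rewrite lte_fin; apply: le_lt_trans sgeps.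
  have sgE : sg = sg `^ al * sg `^ (1 - al).
    by rewrite -powRD_gt0// addrC subrK powRr1// ltW.
  rewrite {1}sgE.
  rewrite (_ : _ * _ = 2 * C4 * (1 + 4 * A) * (p%:R `^ al * sg `^ al) * sg `^ (1 - al)); last by ring.
  rewrite ler_wpM2r ?powR_ge0// -powRM ?(ltW sg0)// -[leRHS]mulrA.
  by rewrite ler_wpM2l ?mulr_ge0// powK.
have c0 : 0 <= C4 * (2 * sg) `^ al by rewrite mulr_ge0 ?powR_ge0.
apply: le_trans (gaps_le _ _ (@wt_ge0 _ _ O al) c0 _) _; first by move=> k bk; case: (GP k) => _ _ _; exact.
rewrite lee_fin; apply: (@le_trans _ _ (2 * C4 * (1 + 4 * A) * (p%:R * sg) `^ al)).
  rewrite !powRM ?(ltW sg0)//.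
  rewrite (_ : C4 * _ * _ = 2 `^ al * (C4 * (1 + 4 * A) * (p%:R `^ al * sg `^ al))); last by ring.
  rewrite mulrA ler_wpM2r ?mulr_ge0 ?powR_ge0//.
  rewrite -[leRHS]mulrA ler_wpM2r ?mulr_ge0//.
  by rewrite -[leRHS]powRr1// ler_powR ?ler1n// ltW.
apply: (@le_trans _ _ (2 * C4 * (1 + 4 * A) * (K * D `^ al))).
  by rewrite ler_wpM2l ?mulr_ge0// powK.
by rewrite mulrA ler_wpM2r ?powR_ge0.
Qed.

End Decimated.

Lemma good_curve_near_boundary eps C x y : 0 < eps -> O x -> O y ->
  0 < enorm (x - y) -> K * enorm (x - y) <= theta0 -> dl O x < 2 * enorm (x - y) ->
  4 * B * K <= C -> 128 <= C -> 64 * N0%:R <= C -> 2 * C4 * K <= C ->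
  2 * C4 * (1 + 4 * A) * K <= C ->
  good_curve O al als C eps x y.
Proof.
move=> eps0 Ox Oy D0 Dth dx h1 h2 h3 h4 h5; have [al0 al1] := andP al01.
set D := enorm (x - y) in D0 Dth dx *.
pose E := 2 * C4 * (1 + 4 * A) * K * D `^ al.
have E0 : 0 <= E.
  have K0 : 0 <= K := le_trans ler01 K_ge1.
  have C40 : 0 <= C4 := le_trans ler01 C4_ge1.
  have A4 : 0 <= 1 + 4 * A by have := A_gt0; lra.
  apply: mulr_ge0 (powR_ge0 _ _); apply: mulr_ge0 K0; apply: mulr_ge0 A4.
  exact: mulr_ge0.
have E1 : 0 < E + 1 by rewrite ltr_wpDl.
(* The three bounds give chains from [x] to [y], replacement curves for steps up to [2 sg], and gap
   length at most [E sg^(1 - al) < eps]; [E + 1] avoids a zero denominator. *)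
pose sg := Num.min D (Num.min (theta0 / 2) ((eps / (E + 1)) `^ (1 - al)^-1)).
have sg0 : 0 < sg by rewrite !lt_min D0 divr_gt0//= powR_gt0// divr_gt0.
have sgD : sg <= D by rewrite ge_min lexx.
have sgt : 2 * sg <= theta0.
  have : sg <= theta0 / 2 by rewrite !ge_min lexx orbT.
  lra.
have sgE : E * sg `^ (1 - al) < eps.
  have al1' : 0 < 1 - al by lra.
  apply: (@le_lt_trans _ _ (E * (eps / (E + 1)))).
    rewrite ler_wpM2l//.
    rewrite -[leRHS](powR_invK (ltW (divr_gt0 eps0 E1)) (lt0r_neq0 al1')).
    rewrite ge0_ler_powR ?nnegrE ?(ltW al1') ?(ltW sg0) ?powR_ge0//.
    by rewrite !ge_min lexx !orbT.
  by rewrite mulrA ltr_pdivrMr// [eps * _]mulrDr mulr1 mulrC ltrDl.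
have [p [Y [[p0 Y0 Yp] YO Ystep Ylong [pK eS]]]] :=
  exists_decimated_quasigeodesic al01 C0_gt0 oO bdO sub sg0 Ox Oy (erefl D) sgD Q5 Qbig dx Dth.
rewrite -Y0 -Yp.
apply: (@decimated_good_curve sg D p Y sg0 sgt D0 p0 YO Ystep pK eS eps C) => //.
by rewrite Y0 Yp.
Qed.

End MainCase.

Theorem theorem1p4 (R : realType) (n : nat) (alpha C0 theta0 : R) :
  0 < alpha < 1 -> 0 < C0 -> 0 < theta0 ->
  exists alpha_s theta C : R,
    0 < alpha_s < alpha /\ 0 < theta /\ 0 < C /\
    forall O : set 'rV[R]_n, domain O -> subhyperbolic alpha O C0 theta0 ->
    forall (eps : R) (x y : 'rV[R]_n), 0 < eps -> O x -> O y ->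
      enorm (x - y) <= theta ->
      exists (Gamma : R -> 'rV[R]_n) (s : seq (R * R)),
        rect_curve O x y Gamma /\ arcs_ok s /\
        (* (i) *)
        (forall tau, alpha_s <= tau <= alpha ->
           (arcs_int Gamma s (wt O tau) <= (C * enorm (x - y) `^ tau)%:E)%E) /\
        (forall (c : 'rV[R]_n) (r : R),
           (exists2 ab, ab \in s & exists2 t, ab.1 <= t <= ab.2 & c = Gamma t) ->
           0 < r -> r <= enorm (x - y) ->
           (diam (eball c r) <= C%:E * arcs_int Gamma s (set_ind (eball c r)))%E) /\
        (* (ii) *)
        (curve_length Gamma 0 1 <= (C * enorm (x - y))%:E)%E /\
        (arcs_int Gamma (gaps s) (fun _ => 1%E) < eps%:E)%E /\
        (arcs_int Gamma (gaps s) (wt O alpha) <= (C * enorm (x - y) `^ alpha)%:E)%E.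
Proof.
move=> al01 C0_gt0 theta0_gt0; have [al0 al1] := andP al01.
have C2_gt0 : 0 < 8 * C0 + 2 by lra.
have [Q Q5 Qbig] := exists_large_ratio al01 C2_gt0.
pose A := 2 * (8 * C0 + 2).
have A1 : 1 <= A by rewrite /A; lra.
have [als [B [als_int [B0 improve]]]] := self_improvement al01 A1.
have [als0 alsal] := andP als_int.
pose K := (8 * C0 + 2) * Q; pose C4 := 1 + 2 * C0 * Q.
have K0 : 0 < K by rewrite mulr_gt0//; lra.
have C40 : 0 < C4 by rewrite ltr_wpDr// !mulr_ge0//; lra.
have [N0 N00 N0big] : exists2 N0 : nat, (0 < N0)%N &
    forall N, (N0 <= N)%N -> 4 * A * N%:R `^ alpha <= N%:R / 2.
  have al1' : 0 < 1 - alpha by lra.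
  (* From this index on [N^(1 - alpha) >= 8 A], which is the required inequality multiplied by
     [2 N^(-alpha)]. *)
  exists (Num.truncn ((8 * A) `^ (1 - alpha)^-1)).+1 => // N hN.
  have N1 : 0 < N%:R :> R by rewrite ltr0n; apply: leq_trans hN.
  have : 8 * A <= N%:R `^ (1 - alpha).
    have A8 : 0 <= 8 * A by lra.
    rewrite -[leLHS](powR_invK A8 (lt0r_neq0 al1')).
    rewrite ge0_ler_powR ?nnegrE ?(ltW al1') ?powR_ge0// ltW//.
    by apply: lt_le_trans (truncnS_gt _) _; rewrite ler_nat.
  move=> /(ler_wpM2r (powR_ge0 N%:R alpha)).
  rewrite -powRD_gt0// subrK powRr1 ?(ltW N1)//; lra.
pose C := 4 * B * K + 128 + 64 * N0%:R + 2 * C4 * K + 2 * C4 * (1 + 4 * A) * K.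
have c1 : 0 <= 4 * B * K by rewrite mulr_ge0 ?(ltW K0)// mulr_ge0// ltW.
have c2 : 0 <= 64 * N0%:R :> R by rewrite mulr_ge0.
have c3 : 0 <= 2 * C4 * K by rewrite mulr_ge0 ?(ltW K0)// mulr_ge0// ltW.
have c4 : 0 <= 2 * C4 * (1 + 4 * A) * K.
  rewrite mulr_ge0 ?(ltW K0)// mulr_ge0//; last by lra.
  by rewrite mulr_ge0// ltW.
exists als, (theta0 / K), C; split=> //; split; first by rewrite divr_gt0.
have C128 : 128 <= C by rewrite /C; lra.
split; first by lra.
move=> O [oO _] sub eps x y eps0 Ox Oy; rewrite ler_pdivlMr// mulrC => xyt.
have C4' : 4 <= C by lra.
rewrite -/(good_curve O alpha als C eps x y).
have [xy0|xyn0] := eqVneq (enorm (x - y)) 0.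
  have -> : y = x by apply/esym/eqP; rewrite -subr_eq0; apply/eqP; exact: enorm_eq0.
  exact: good_curve_refl.
have D0 : 0 < enorm (x - y) by rewrite lt_neqAle eq_sym xyn0 enorm_ge0.
(* With empty boundary [O] is the whole space and the weight is 0 by convention for exponents below
   1, so the segment works. *)
have [bdO|bd0] := pselect (bd O !=set0); last first.
  have allO z : O z.
    by apply: contrapT => Oz; have [w bw _] := bd_between Ox Oz; apply: bd0; exists w.
  apply: good_curve_segment => // tau t tau1 _; rewrite /wt.
  have -> : dist_bd O (segment x y t) = +oo%E.
    rewrite /dist_bd (_ : bd O = set0) ?image_set0 ?ereal_inf0//.
    by apply: contrapT => /eqP/set0P.
  by rewrite tau1 lee_fin powR_ge0.
(* Deep inside the domain the segment keeps distance at least [|x - y|] from the boundary, and its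
   weight is at most [|x - y|^(tau - 1)]. *)
have [dx|dx] := leP (2 * enorm (x - y)) (dl O x).
  have dseg t : 0 <= t <= 1 -> enorm (x - y) <= dl O (segment x y t).
    move=> t01; have := enorm_segment_start x y t01.
    by have := dl_lip bdO x (segment x y t); lra.
  apply: good_curve_segment => // [t t01|tau t tau1 t01].
    apply: (dl_ball bdO Ox); apply: le_lt_trans (enorm_segment_start _ _ t01) _.
    lra.
  by rewrite wtE// lee_fin le_powR_neg ?dseg//; lra.
apply: (good_curve_near_boundary al01 C0_gt0 theta0_gt0 oO bdO sub Q5 Qbig als0 B0
  improve N00 N0big eps0 Ox Oy D0 xyt dx); rewrite /C /K /C4 /A in c1 c2 c3 c4 *; lra.
Qed.
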